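(* Let $F$ be a totally real number field of degree $n$ over $\mathbb{Q}$. Fix a weight $k=(k_1,\dots,k_n)\in\mathbb{N}^n$ with $k_j>2$ for all $j$ and a totally positive $\nu\in\mathcal{O}_F^*$. Then there exists a positive constant $n_0$ such that the Hilbert Poincaré series $\mathcal{P}_{k,\nu,\mathcal{I}}$ is not identically zero for every non-zero integral ideal $\mathcal{I}\subseteq\mathcal{O}_F$ with $\mathcal{N}(\mathcal{I})\geq n_0$, where $\mathcal{N}(\mathcal{I})=[\mathcal{O}_F:\mathcal{I}]$.
   Context: $F$ has real embeddings $\sigma_1,\dots,\sigma_n$; $\alpha_j=\sigma_j(\alpha)$; $\alpha\gg0$ means all $\alpha_j>0$. $\mathcal{O}_F^*=\{\mu\in F:\mathrm{tr}(\mu\mathcal{O}_F)\subseteq\mathbb{Z}\}$. $SL_2(\mathcal{O}_F)$ acts on $\mathbb{H}^n$ componentwise via the embeddings by Möbius transformations. For $M=\begin{pmatrix}*&*\\ \gamma&\delta\end{pmatrix}\in SL_2(\mathcal{O}_F)$, $z\in\mathbb{H}^n$, $k\in\mathbb{Z}^n$: $\mu(M,z)^{k}=\prod_{j}(\gamma_jz_j+\delta_j)^{k_j}$; $\mathrm{tr}(mz)=\sum_j m_jz_j$. $\Gamma_0(\mathcal{I})=\{\begin{pmatrix}\alpha&\beta\\ \gamma&\delta\end{pmatrix}\in SL_2(\mathcal{O}_F):\gamma\in\mathcal{I}\}$, $\Gamma_\infty=\{\begin{pmatrix}1&\mu\\0&1\end{pmatrix}:\mu\in\mathcal{O}_F\}$.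 For $k$ with all $k_j>2$ and totally positive $\nu\in\mathcal{O}_F^*$, $\mathcal{P}_{k,\nu,\mathcal{I}}(z)=\sum_{M\in\Gamma_\infty\backslash\Gamma_0(\mathcal{I})}\mu(M,z)^{-k}e^{2\pi i\,\mathrm{tr}(\nu(Mz))}$.
   Formalization: The formal statement adds that k_1+...+k_n is even: since -1 lies in Γ_0(I) but not in Γ_∞, for an odd sum the terms of M and -M cancel and the series is identically zero for every I (e.g. F=Q, k=3, ν=1). *)

(* Defs.v *)
From HB Require Import structures.
From mathcomp Require Import all_boot all_order all_algebra all_field.
From mathcomp Require Import finmap complex.
From mathcomp Require Import all_classical all_reals all_analysis.
From mathcomp Require Import ring.
From mathcomp Require summability.

Set Implicit Arguments.
Unset Strict Implicit.
Unset Printing Implicit Defensive.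

Import Order.TTheory GRing.Theory Num.Theory.
Import numFieldNormedType.Exports.

Local Open Scope classical_set_scope.
Local Open Scope ring_scope.
Local Open Scope complex_scope.

(* [F : fieldExtType rat] is a number field, of degree [\dim {:F}]. *)
Definition totally_real (R : realType) (F : fieldExtType rat) : Prop :=
  forall (f : {rmorphism F -> R[i]}) (x : F), f x \is Num.real.

Definition enumerates_real_embeddings (R : realType) (F : fieldExtType rat)
    (n : nat) (sigma : 'I_n -> {rmorphism F -> R}) : Prop :=
  (forall i j, sigma i =1 sigma j -> i = j) /\
  (forall f : {rmorphism F -> R}, exists j, sigma j =1 f).

Definition integers (F : fieldExtType rat) : set F :=
  [set x | integralOver (intr : int -> F) x].

Definition trace (R : realType) (F : fieldExtType rat) (n : nat)
    (sigma : 'I_n -> {rmorphism F -> R}) (x : F) : R :=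
  \sum_j sigma j x.

Definition dual_integers (R : realType) (F : fieldExtType rat) (n : nat)
    (sigma : 'I_n -> {rmorphism F -> R}) : set F :=
  [set m | forall x, integers x -> trace sigma (m * x) \is a Num.int].

Definition totally_positive (R : realType) (F : fieldExtType rat) (n : nat)
    (sigma : 'I_n -> {rmorphism F -> R}) (x : F) : Prop :=
  forall j, 0 < sigma j x.

Definition integral_ideal (F : fieldExtType rat) (I : set F) : Prop :=
  [/\ I `<=` @integers F,
      I 0,
      forall x y, I x -> I y -> I (x + y)
    & forall a x, integers a -> I x -> I (a * x)].

Definition ideal_cosets (F : fieldExtType rat) (I : set F) : set (set F) :=
  [set [set x + a | a in I] | x in @integers F].

(* The index of [I] in the ring of integers. [fset_set] sends an infinite set to
   the empty one, but a nonzero integral ideal has finite index. *)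
Definition ideal_norm (F : fieldExtType rat) (I : set F) : nat :=
  #|` fset_set (ideal_cosets I)|%fset.

Definition SL2_integers (F : fieldExtType rat) : set 'M[F]_2 :=
  [set M : 'M[F]_2 | (forall i j, integers (M i j)) /\ \det M = 1].

Definition Gamma0 (F : fieldExtType rat) (I : set F) : set 'M[F]_2 :=
  [set M : 'M[F]_2 | SL2_integers M /\ I (M 1 0)].

Definition Gamma_inf (F : fieldExtType rat) : set 'M[F]_2 :=
  [set M : 'M[F]_2 | [/\ M 0 0 = 1, M 1 0 = 0, M 1 1 = 1 & integers (M 0 1)]].

Definition coset_inf (F : fieldExtType rat) (M : 'M[F]_2) : set 'M[F]_2 :=
  [set U *m M | U in @Gamma_inf F].

Definition quotient_inf (F : fieldExtType rat) (I : set F) :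
    set (set 'M[F]_2) :=
  [set coset_inf M | M in Gamma0 I].

Definition upper_half (R : realType) (n : nat) : set ('I_n -> R[i]) :=
  [set z | forall j, 0 < complex.Im (z j)].

Definition denom (R : realType) (F : fieldExtType rat) (n : nat)
    (sigma : 'I_n -> {rmorphism F -> R}) (M : 'M[F]_2) (z : 'I_n -> R[i])
    (j : 'I_n) : R[i] :=
  (sigma j (M 1 0))%:C * z j + (sigma j (M 1 1))%:C.

Definition moebius (R : realType) (F : fieldExtType rat) (n : nat)
    (sigma : 'I_n -> {rmorphism F -> R}) (M : 'M[F]_2) (z : 'I_n -> R[i]) :
    'I_n -> R[i] :=
  fun j => ((sigma j (M 0 0))%:C * z j + (sigma j (M 0 1))%:C)
           / denom sigma M z j.

Definition automorphy (R : realType) (F : fieldExtType rat) (n : nat)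
    (sigma : 'I_n -> {rmorphism F -> R}) (k : 'I_n -> int) (M : 'M[F]_2)
    (z : 'I_n -> R[i]) : R[i] :=
  \prod_j denom sigma M z j ^ k j.

Definition ztrace (R : realType) (F : fieldExtType rat) (n : nat)
    (sigma : 'I_n -> {rmorphism F -> R}) (m : F) (z : 'I_n -> R[i]) : R[i] :=
  \sum_j (sigma j m)%:C * z j.

Definition cexp (R : realType) (w : R[i]) : R[i] :=
  (expR (complex.Re w))%:C * (cos (complex.Im w) +i* sin (complex.Im w)).

Definition poincare_term (R : realType) (F : fieldExtType rat) (n : nat)
    (sigma : 'I_n -> {rmorphism F -> R}) (k : 'I_n -> nat) (nu : F)
    (z : 'I_n -> R[i]) (M : 'M[F]_2) : R[i] :=
  automorphy sigma (fun j => - (k j)%:Z) M z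
  * cexp (2 * (pi : R)%:C * 'i%C * ztrace sigma nu (moebius sigma M z)).

(* Unordered sum (limit over the finite subsets) of the terms of the cosets
   [Gamma_inf * M], each evaluated at a representative [xget 0 C]; the choice is
   immaterial for [nu] in the dual of the integers (see poincare_term_coset).
   The limit is 0 where the series does not converge. *)
Definition poincare (R : realType) (F : fieldExtType rat) (n : nat)
    (sigma : 'I_n -> {rmorphism F -> R}) (k : 'I_n -> nat) (nu : F)
    (I : set F) (z : 'I_n -> R[i]) : R[i] :=
  summability.sum (fun C : set 'M[F]_2 =>
    (if C \in quotient_inf I then poincare_term sigma k nu z (xget 0 C) else 0)
    : R[i]^o).

Lemma det2 (F : fieldType) (M : 'M[F]_2) : \det M = M 0 0 * M 1 1 - M 0 1 * M 1 0.
Proof.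
rewrite (expand_det_row _ 0) !big_ord_recl big_ord0 /cofactor !det_mx11 !mxE /=.
have -> : lift ord0 ord0 = 1 :> 'I_2 by apply: val_inj.
have -> : lift 1 0 = 0 :> 'I_2 by apply: val_inj.
rewrite /= addr0 expr0 mul1r expr1 mulN1r mulrN //.
Qed.

Lemma denom_neq0 (R : realType) (F : fieldExtType rat) (n : nat)
    (sigma : 'I_n -> {rmorphism F -> R}) (M : 'M[F]_2) (z : 'I_n -> R[i]) j :
  \det M = 1 -> upper_half z -> denom sigma M z j != 0.
Proof.
rewrite det2 /denom => detM /(_ j); case: (z j) => a b /= b_gt0.
apply/eqP => -[] /=; rewrite !mul0r !addr0 => /eqP e1 /eqP.
rewrite mulf_eq0 (gt_eqF b_gt0) orbF fmorph_eq0 => /eqP c0.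
move: e1; rewrite c0 rmorph0 mul0r subr0 add0r fmorph_eq0 => /eqP d0.
by move/eqP: detM; rewrite c0 d0 !mulr0 subrr eq_sym oner_eq0.
Qed.

Lemma cexpD (R : realType) (v w : R[i]) : cexp (v + w) = cexp v * cexp w.
Proof.
case: v w => [a b] [c d]; rewrite /cexp /= expRD cosD sinD; congr (_ +i* _) => /=; ring.
Qed.

Lemma cexp_int (R : realType) (m : int) :
  cexp (2 * (pi : R)%:C * 'i%C * (m%:~R : R)%:C) = 1.
Proof.
have cexpn (p : nat) : cexp (2 * (pi : R)%:C * 'i%C * (p%:R : R)%:C) = 1.
  have -> : 2 * (pi : R)%:C * 'i%C * (p%:R : R)%:C = 0 +i* (pi *+ 2 *+ p).
    rewrite -[2](rmorph_nat (real_complex R) 2%N) mulrAC -!rmorphM /=.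
    apply/eqP; rewrite eq_complex /= !mulr0 !mul0r subrr addr0 mulr1 eqxx /=.
    by rewrite mulr_natr mulr_natl.
  rewrite /cexp.
  rewrite /= expR0 -[pi *+ 2 *+ p]add0r (periodicn (@cosD2pi R)).
  have -> : sin (0 + pi *+ 2 *+ p) = 0 :> R.
    elim: p => [|p IH]; first by rewrite addr0 sin0.
    by rewrite mulrS addrCA addrC sinD2pi.
  by rewrite cos0 mul1r.
case: m => p; first exact: cexpn.
have := cexpD (2 * (pi : R)%:C * 'i%C * ((Negz p)%:~R : R)%:C) (2 * (pi : R)%:C * 'i%C * (p.+1%:R : R)%:C).
rewrite cexpn mulr1 => <-; rewrite -mulrDr -rmorphD /= NegzE mulrNz -pmulrn addNr.
by rewrite mulr0 -(cexpn 0%N) mulr0.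
Qed.

Lemma poincare_term_coset (R : realType) (F : fieldExtType rat) (n : nat)
    (sigma : 'I_n -> {rmorphism F -> R}) (k : 'I_n -> nat) (nu : F)
    (z : 'I_n -> R[i]) (U M : 'M[F]_2) :
  dual_integers sigma nu -> upper_half z -> Gamma_inf U -> \det M = 1 ->
  poincare_term sigma k nu z (U *m M) = poincare_term sigma k nu z M.
Proof.
move=> nuP zP [U00 U10 U11 U01] detM.
have l1 : lift ord0 ord0 = 1 :> 'I_2 by apply: val_inj.
have UM i j : (U *m M) i j = U i 0 * M 0 j + U i 1 * M 1 j.
  by rewrite mxE !big_ord_recl big_ord0 addr0 l1.
have dE j : denom sigma (U *m M) z j = denom sigma M z j.
  by rewrite /denom !UM U10 U11 !mul0r !mul1r !add0r.
rewrite /poincare_term; congr (_ * _).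
  by rewrite /automorphy; apply: eq_bigr => j _; rewrite dE.
have -> : ztrace sigma nu (moebius sigma (U *m M) z) =
    ztrace sigma nu (moebius sigma M z) + (trace sigma (nu * U 0 1))%:C.
  rewrite /ztrace /trace rmorph_sum -big_split; apply: eq_bigr => j _ /=.
  rewrite /moebius dE !UM U00 rmorphM rmorphM -mulrDr; congr (_ * _).
  rewrite -[X in _ = _ + X](mulfK (denom_neq0 sigma j detM zP)) -mulrDl.
  congr (_ / _); rewrite /denom !mul1r !rmorphD !rmorphM /=; ring.
have /intrP[m ->] := nuP _ U01.
by rewrite mulrDr cexpD cexp_int mulr1.
Qed.

Lemma poincare_termN (R : realType) (F : fieldExtType rat) (n : nat)
    (sigma : 'I_n -> {rmorphism F -> R}) (k : 'I_n -> nat) (nu : F)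
    (z : 'I_n -> R[i]) (M : 'M[F]_2) :
  poincare_term sigma k nu z (- M) =
  (-1) ^+ (\sum_j k j) * poincare_term sigma k nu z M.
Proof.
have dE j : denom sigma (- M) z j = - denom sigma M z j.
  by rewrite /denom !mxE !rmorphN /=; ring.
have -> : poincare_term sigma k nu z (- M) =
    automorphy sigma (fun j => - (k j)%:Z) (- M) z
    * cexp (2 * (pi : R)%:C * 'i%C * ztrace sigma nu (moebius sigma M z)).
  rewrite /poincare_term; congr (_ * _).
  have -> // : moebius sigma (- M) z = moebius sigma M z.
  apply/funext => j; rewrite /moebius dE !mxE !rmorphN /= invrN mulrN -mulNr.
  congr (_ * _); ring.
have -> : automorphy sigma (fun j => - (k j)%:Z) (- M) z =
    (-1) ^+ (\sum_j k j) * automorphy sigma (fun j => - (k j)%:Z) M z.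
  rewrite /automorphy -prodrXr -big_split; apply: eq_bigr => j _ /=.
  by rewrite dE -!exprnN -!exprVn invrN -[in LHS]mulN1r exprMn.
exact: esym (mulrA _ _ _).
Qed.

(* Since [- 1%:M] is in [Gamma0 I], the terms of [M] and [- M] cancel when the
   weights have an odd sum: nonvanishing needs this sum to be even. *)
Lemma poincare_odd (R : realType) (F : fieldExtType rat) (n : nat)
    (sigma : 'I_n -> {rmorphism F -> R}) (k : 'I_n -> nat) (nu : F)
    (I : set F) (z : 'I_n -> R[i]) :
  integral_ideal I -> dual_integers sigma nu -> upper_half z ->
  odd (\sum_j k j)%N -> poincare sigma k nu I z = 0.
Proof.
move=> [IO I0 ID IM] nuP zP kodd; rewrite /poincare.
set f := (fun C : set _ => _).
pose g (C : set 'M[F]_2) : set 'M[F]_2 := [set - N | N in C].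
have gK : involutive g.
  move=> C; apply/seteqP; split=> [N [_ [N' CN' <-] <-]|N CN]; first by rewrite opprK.
  by exists (- N); [exists N|rewrite opprK].
have detN (M : 'M[F]_2) : \det (- M) = \det M by rewrite -scaleN1r detZ sqrrN expr1n mul1r.
have intN (x : F) : integers x -> integers (- x) by exact: integral_opp.
have gcoset M : g (coset_inf M) = coset_inf (- M).
  apply/seteqP; split=> [_ [_ [U UP <-] <-]|_ [U UP <-]].
    by exists U; rewrite ?mulmxN.
  by exists (U *m M); [exists U|rewrite mulmxN].
have I_N x : I x -> I (- x).
  by move=> Ix; rewrite -mulN1r; apply: IM => //; apply: intN; exact: integral1.
have G0N M : Gamma0 I M -> Gamma0 I (- M).
  move=> [[MO dM] MI]; split; last by rewrite mxE; apply: I_N.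
  by split=> [i j|]; rewrite ?detN // mxE; apply: intN.
have gQ C : quotient_inf I C -> quotient_inf I (g C).
  by move=> [M MP <-]; exists (- M); rewrite ?gcoset //; apply: G0N.
have one_inf : @Gamma_inf F 1%:M.
  by split; rewrite ?mxE //; exact: mxpoly.integral0.
have frep M : Gamma0 I M -> f (coset_inf M) = poincare_term sigma k nu z M.
  move=> MP; rewrite /f mem_set; last by exists M.
  have : coset_inf M (xget 0 (coset_inf M)).
    by apply: xgetPex; exists M; exists 1%:M; rewrite ?mul1mx.
  by move=> [U UP <-]; rewrite poincare_term_coset //; case: MP => -[].
have fg C : f (g C) = - f C.
  have [[M MP <-]|nQ] := pselect (quotient_inf I C).
    rewrite gcoset !frep //; last exact: G0N.
    by rewrite poincare_termN -signr_odd kodd expr1 mulN1r.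
  rewrite /f !memNset ?oppr0 // => /gQ; rewrite gK //.
pose G (A : {fset set 'M[F]_2}) := (g @` A)%fset.
have sG A : summability.partial_sum f (G A) = - summability.partial_sum f A.
  rewrite /summability.partial_sum -!(big_seq_fsetE _ _ predT f) /= big_imfset /=; last first.
    by move=> ? ? _ _; exact: (inv_inj gK).
  by rewrite -sumrN; apply: eq_bigr => C _; rewrite fg.
have Gtot : G @ summability.totally `=>` summability.totally.
  move=> P [A _ AP]; exists (G A) => // B /fsubsetP GAB; apply: AP.
  apply/fsubsetP => C CA; apply/imfsetP; exists (g C); rewrite ?gK //=.
  by apply: GAB; apply/imfsetP; exists C.
pose s : {fset set 'M[F]_2} -> R[i]^o := summability.partial_sum f.
have -> : summability.sum (f : _ -> R[i]^o) = lim (s @ summability.totally) by [].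
have [cs|/dvgP -> //] := pselect (cvg (s @ summability.totally)).
set l := lim _ in cs *.
have FF := @summability.totally_filter (set 'M[F]_2 : choiceType).
have c1 : (fun A => - s A) @ summability.totally --> l.
  have -> : (fun A => - s A) = s \o G by apply/funext => A; rewrite /= [RHS]sG.
  by apply: cvg_trans cs => P /Gtot.
have c2 := cvgN cs.
have e : l = - l.
  have PF : ProperFilter ((fun A => - s A) @ summability.totally) by apply: fmap_proper_filter.
  exact: (@cvg_unique R[i]^o (@norm_hausdorff _ R[i]^o) _ PF l (- l) c1 (c2 _)).
have : l *+ 2 == 0 by rewrite mulr2n {1}e addNr.
by rewrite (mulrn_eq0 (l : R[i])) /= => /eqP.
Qed.

(* Main.v *)
Require Import Defs.
From HB Require Import structures.
From mathcomp Require Import all_boot all_order all_algebra all_field.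
From mathcomp Require Import finmap complex.
From mathcomp Require Import all_classical all_reals all_analysis.
From mathcomp Require Import ring lra.

(** Evaluate the series at z = i t / nu. The term of a coset with bottom row
    (gamma, delta) then has absolute value
    prod_j r_j^(-k_j) exp(-2 pi t / r_j^2), with r_j = |gamma_j z_j + delta_j|.
    The exponential controls it for small r_j, so that it is at most a constant
    (depending on t) times prod_j ((1 + |gamma_j|) (1 + |delta_j|))^(-3/2), which
    is summable over all pairs of integers.

    The rows (0, 1) and (0, -1) contribute 2 exp(-2 pi t n). In any other row with
    gamma = 0, delta is a unit, and sum_j delta_j^(-2) exceeds n by a fixed gap, by
    the inequality of arithmetic and geometric means and since norms of nonzero
    integers are at least 1: for t large these rows contribute little. With t fixed,
    the rows with gamma <> 0 contribute part of a tail of a convergent series, since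
    an ideal containing a given nonzero gamma has bounded norm. *)

Set Implicit Arguments.
Unset Strict Implicit.
Unset Printing Implicit Defensive.

Import Order.TTheory GRing.Theory Num.Theory.
Import numFieldNormedType.Exports.

Local Open Scope classical_set_scope.
Local Open Scope ring_scope.
Local Open Scope complex_scope.

(** * Algebraic integers, and families of them spanning [F] over the rationals *)

Lemma integers_int (F : fieldExtType rat) (m : int) :
  integers (m%:~R : F).
Proof. exact: integral_id. Qed.

Lemma integersD (F : fieldExtType rat) (x y : F) :
  integers x -> integers y -> integers (x + y).
Proof. exact: integral_add. Qed.

Lemma integersN (F : fieldExtType rat) (x : F) : integers x -> integers (- x).
Proof. exact: integral_opp. Qed.

Lemma integersM (F : fieldExtType rat) (x y : F) :
  integers x -> integers y -> integers (x * y).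
Proof. exact: integral_mul. Qed.

Lemma integers_sum (F : fieldExtType rat) (J : finType) (f : J -> F) :
  (forall j, integers (f j)) -> integers (\sum_j f j).
Proof.
move=> fP; elim/big_ind : _ => //; first exact: mxpoly.integral0.
exact: integral_add.
Qed.

Lemma intr_fieldExt_eq0 (F : fieldExtType rat) (m : int) :
  ((m%:~R : F) == 0) = (m == 0).
Proof.
by rewrite -(rmorph_int (in_alg F)) fmorph_eq0 intr_eq0.
Qed.

(** Clearing denominators in the minimal polynomial gives an integral polynomial [q]; multiplying
    [x] by its leading coefficient makes the equation monic. *)
Lemma integers_denominator (F : fieldExtType rat) (x : F) :
  exists d : int, d != 0 /\ integers (d%:~R * x).
Proof.
have /polyOver1P[p pE] := minPolyOver 1%AS x.
have [q [a a0 qE]] := rat_poly_scale p.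
have p0 : p != 0.
  apply/eqP => p0; have := monic_minPoly 1%AS x.
  by rewrite pE p0 map_poly0 monicE lead_coef0 eq_sym oner_eq0.
have q0 : q != 0.
  by apply: contra_neq p0 => q0; rewrite qE q0 map_poly0 scaler0.
have qx : root (map_poly (intr : int -> F) q) x.
  have := root_minPoly 1%AS x; rewrite pE qE !map_polyZ -map_poly_comp.
  rewrite rootZ; last by rewrite fmorph_eq0 invr_eq0 intr_eq0.
  by rewrite (eq_map_poly (g := intr)) // => m /=; rewrite scaler_int.
exists (lead_coef q); split; first by rewrite lead_coef_eq0.
set b : F := (lead_coef q)%:~R.
have b0 : b != 0 by rewrite intr_fieldExt_eq0 lead_coef_eq0.
case sq: (size q) => [|s]; first by move/eqP: sq; rewrite size_poly_eq0 (negPf q0).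
have bE : b = (q`_s)%:~R by rewrite /b lead_coefE sq.
case: s => [|s] in sq bE *.
  move/eqP: sq => /size_poly1P[c c0 qc]; move: qx; rewrite qc map_polyC rootC /=.
  by rewrite intr_fieldExt_eq0 (negPf c0).
(* P = b^s q(X / b), for q of degree s + 1 with leading coefficient b. *)
pose P : {poly F} := 'X^(s.+1) + \poly_(i < s.+1) ((q`_i)%:~R * b ^+ (s - i)).
have sP : (size (\poly_(i < s.+1) ((q`_i)%:~R * b ^+ (s - i)%N)%R) < size ('X^(s.+1) : {poly F}))%N.
  by rewrite size_polyXn ltnS size_poly.
apply: (@integral_root_monic _ _ _ (b * x) P).
- by rewrite monicE lead_coefDl // lead_coefXn.
- rewrite /root hornerD hornerXn horner_poly.
  move: qx; rewrite /root horner_coef size_map_inj_poly ?rmorph0 //; last first.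
    move=> u v /eqP; rewrite -subr_eq0 -rmorphB intr_fieldExt_eq0 subr_eq0.
    by move/eqP.
  have cE : (map_poly (intr : int -> F) q)`_s.+1 = b by rewrite coef_map bE.
  rewrite sq big_ord_recr /= cE => /eqP qx.
  rewrite exprMn exprSr -mulrA -[X in X == 0](mulfK b0).
  rewrite (_ : _ * b = 0) ?mul0r //.
  have -> : b ^+ s * (b * x ^+ s.+1) + \sum_(i < s.+1) (q`_i)%:~R * b ^+ (s - i) * (b * x) ^+ i
    = b ^+ s * (\sum_(i < s.+1) (map_poly intr q)`_i * x ^+ i + b * x ^+ s.+1).
    rewrite mulrDr addrC mulr_sumr; congr (_ + _); apply: eq_bigr => i _.
    have lis : (i <= s)%N by rewrite -ltnS.
    have -> : b ^+ s = b ^+ (s - i) * b ^+ i by rewrite -exprD subnK.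
    rewrite coef_map exprMn /=; ring.
  by rewrite qx mulr0 mul0r.
- move=> c /(nthP 0)[i _ <-]; rewrite coefD coefXn coef_poly.
  apply: integral_add; first by exact: integral_nat.
  case: ifP => _; last exact: mxpoly.integral0.
  by rewrite -rmorphXn -rmorphM; exact: integral_id.
Qed.

(** Only a rational span is asked for, so a vector space basis scaled into the ring of integers
    serves. *)
Lemma integral_basis (F : fieldExtType rat) (n : nat) : \dim {:F} = n ->
  exists e : 'I_n -> F, (forall i, integers (e i)) /\
    forall x, exists q : 'I_n -> rat, x = \sum_i q i *: e i.
Proof.
move=> <-; pose b := vbasis {:F}.
have [d dP] : exists d : 'I_(\dim {:F}) -> int,
    forall i, d i != 0 /\ integers ((d i)%:~R * b`_i).
  have P i : exists d : int, d != 0 /\ integers (d%:~R * b`_i).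
    exact: integers_denominator.
  by have [d dP] := choice P; exists d => i; exact: dP.
exists (fun i => (d i)%:~R * b`_i); split=> [i|x]; first by case: (dP i).
exists (fun i => coord b i x / (d i)%:~R).
rewrite {1}(coord_vbasis (memvf x)); apply: eq_bigr => i _.
have -> : ((d i)%:~R : F) * b`_i = (d i)%:~R *: b`_i.
  by rewrite -[X in _ = _ *: X]mul1r scalerAl; congr (_ * _); rewrite -(rmorph_int (in_alg F)).
rewrite scalerA divfK // intr_eq0; by case: (dP i).
Qed.

(** * Conjugates: independence, finiteness of boxes, norms and ideal indices *)

(** Induction on the number of nonzero coefficients: the relation at [y * x] minus [sigma i y] times
    the relation at [x] has lost its [i]-th coefficient. *)
Lemma rmorph_independent (K L : fieldType) (n : nat)
    (sigma : 'I_n -> {rmorphism K -> L}) (c : 'I_n -> L) :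
  (forall i j, sigma i =1 sigma j -> i = j) ->
  (forall x, \sum_j c j * sigma j x = 0) -> forall j, c j = 0.
Proof.
move=> sigmaI.
suff IH m : forall c : 'I_n -> L, (#|[set j | c j != 0%R]%SET| <= m)%N ->
    (forall x, \sum_j c j * sigma j x = 0) -> forall j, c j = 0.
  exact: IH (leqnn _).
elim: m => [|m IH] {}c.
  rewrite leqn0 cards_eq0 => /eqP s0 _ j; apply/eqP; apply: contraT => cj.
  by move/setP/(_ j) : s0; rewrite !inE cj.
move=> cm c0 i; apply/eqP; apply: contraT => ci.
have cl l : l != i -> c l = 0.
  move=> li; have [y yP] : exists y, sigma l y != sigma i y.
    apply: contrapT => nE; move/eqP: li; apply; apply: sigmaI => y.
    by apply/eqP; apply: contraT => h; case: nE; exists y.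
  have c'0 j : c j * (sigma j y - sigma i y) = 0.
    move: j; apply: IH => [|x].
      rewrite -ltnS; apply: leq_trans cm; apply: proper_card; apply/properP; split.
        by apply/fintype.subsetP => j; rewrite !inE mulf_eq0 negb_or => /andP[].
      by exists i; rewrite inE // subrr mulr0 eqxx.
    under eq_bigr => j _ do rewrite mulrBr mulrBl -mulrA -rmorphM [c j * sigma i y]mulrC -mulrA.
    by rewrite sumrB -mulr_sumr !c0 mulr0 subrr.
  by move/eqP: (c'0 l); rewrite mulf_eq0 subr_eq0 (negPf yP) orbF => /eqP.
have := c0 1; rewrite (bigD1 i) //= big1 ?addr0; last by move=> l li; rewrite cl // mul0r.
by rewrite rmorph1 mulr1 => /eqP; rewrite (negPf ci).
Qed.

Lemma rmorph_scale (R : realType) (F : fieldExtType rat) (f : {rmorphism F -> R})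
    (q : rat) (x : F) : f (q *: x) = ratr q * f x.
Proof.
rewrite -[x in LHS]mul1r scalerAl rmorphM; congr (_ * _).
exact: (fmorph_eq_rat (f \o in_alg F)).
Qed.

Lemma integral_rat (q : rat) : integralOver (intr : int -> rat) q -> q \is a Num.int.
Proof.
move=> [p p_mon pq].
have : (ratr q : algC) \is a Num.int.
  apply: Cint_rat_Aint; first exact: Crat_rat.
  apply: (@root_monic_Aint (map_poly (intr : int -> algC) p)).
  - rewrite (eq_map_poly (g := ratr \o intr)); last by move=> m /=; rewrite ratr_int.
    by rewrite map_poly_comp fmorph_root.
  - exact: monic_map.
  - by apply/polyOverP => i; rewrite coef_map /= intr_int.
by move=> /intrP[m]; rewrite -ratr_int => /fmorph_inj ->; exact: intr_int.
Qed.

Lemma finite_of_inj (T : choiceType) (U : finType) (x0 : T) (S : set T) (p : T -> U) :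
  (forall x y, S x -> S y -> p x = p y -> x = y) ->
  exists s : seq T, forall x, S x -> x \in s.
Proof.
move=> pI; exists [seq xget x0 [set x | S x /\ p x = u] | u <- enum U] => x Sx.
apply/mapP; exists (p x); first by rewrite mem_enum.
have [Sy py] : [set y | S y /\ p y = p x] (xget x0 [set y | S y /\ p y = p x]).
  by apply: xgetPex; exists x.
by apply: pI.
Qed.

(** By rational linearity the relation extends from the [e i] to all of [F], where the embeddings
    are independent. This stands in for a nonzero discriminant. *)
Lemma separating_basis (R : realType) (F : fieldExtType rat) (n : nat)
    (sigma : 'I_n -> {rmorphism F -> R}) (e : 'I_n -> F) (w : 'I_n -> R) :
  (forall i j, sigma i =1 sigma j -> i = j) ->
  (forall x, exists q : 'I_n -> rat, x = \sum_i q i *: e i) ->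
  (forall i, \sum_j w j * sigma j (e i) = 0) -> forall j, w j = 0.
Proof.
move=> sigmaI eP we; apply: (rmorph_independent sigmaI) => x.
have [q ->] := eP x.
under eq_bigr => j _ do rewrite rmorph_sum mulr_sumr.
rewrite exchange_big big1 // => i _ /=.
under eq_bigr => j _ do rewrite rmorph_scale mulrCA.
by rewrite -mulr_sumr we mulr0.
Qed.

Lemma degree_gt0 (F : fieldExtType rat) (n : nat) : \dim {:F} = n -> (0 < n)%N.
Proof. by move=> <-; exact: adim_gt0. Qed.

(* For a basis e of integers, the rational integers tr(nu e_i x) determine x and are
   bounded in terms of its conjugates. *)
Lemma box_finite (R : realType) (F : fieldExtType rat) (n : nat)
    (sigma : 'I_n -> {rmorphism F -> R}) (nu : F) (B : R) :
  \dim {:F} = n -> (forall i j, sigma i =1 sigma j -> i = j) ->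
  dual_integers sigma nu -> totally_positive sigma nu ->
  exists s : seq F, forall x, integers x -> (forall j, `|sigma j x| <= B) -> x \in s.
Proof.
move=> degF sigmaI nu_dual nu_pos; have n_gt0 := degree_gt0 degF.
have [e [eO eP]] := integral_basis degF.
pose m (x : F) i := trace sigma (nu * (e i * x)).
have mE x i : m x i = \sum_j (sigma j nu * sigma j x) * sigma j (e i).
  by apply: eq_bigr => j _; rewrite !rmorphM -mulrA [sigma j x * _]mulrC.
have mD x y i : m (x - y) i = m x i - m y i.
  by rewrite /m /trace -sumrB; apply: eq_bigr => j _; rewrite -rmorphB -!mulrBr.
have m_int x i : integers x -> m x i \is a Num.int.
  by move=> xO; apply: nu_dual; apply: integersM.
pose t i := Num.truncn (\sum_j (sigma j nu * B) * `|sigma j (e i)|).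
pose N := (\max_i t i).+1.
have mN x i : (forall j, `|sigma j x| <= B) -> `|m x i| <= N%:R.
  move=> xB; rewrite mE; apply: (@le_trans _ _ (\sum_j (sigma j nu * B) * `|sigma j (e i)|)).
    apply: le_trans (ler_norm_sum _ _ _) _; apply: ler_sum => j _.
    rewrite !normrM (gtr0_norm (nu_pos j)) ler_wpM2r // ler_wpM2l //; exact: ltW.
  apply/ltW; apply: lt_le_trans (truncnS_gt _) _.
  rewrite ler_nat ltnS; exact: (leq_bigmax (F := t)).
(* For [x] in the box each [m x i] is an integer in [-N, N]; the shift by [N] makes it a natural
   number at most [N + N]. *)
pose p x := [ffun i => inord (Num.truncn (m x i + N%:R))] : {ffun 'I_n -> 'I_(N + N).+1}.
have [|s sP] := @finite_of_inj _ _ 0 [set x | integers x /\ forall j, `|sigma j x| <= B] p.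
  move=> x y [xO xB] [yO yB] /ffunP pxy.
  have pE z i : integers z -> (forall j, `|sigma j z| <= B) -> (p z i)%:R = m z i + N%:R.
    move=> zO zB; have := mN _ i zB; rewrite ler_norml => /andP[m1 m2].
    have mn : m z i + N%:R \is a Num.nat.
      by rewrite natrEint rpredD ?m_int ?intr_nat //= -lerBlDr sub0r.
    rewrite ffunE inordK ?truncnK // ltnS -(ler_nat R) truncnK // natrD.
    by rewrite lerD2r.
  have w0 := separating_basis (w := fun j => sigma j nu * sigma j (x - y)) sigmaI eP.
  (* One vanishing conjugate suffices; an index exists because n > 0. *)
  have /w0/(_ (Ordinal n_gt0))/eqP : forall i,
      \sum_j sigma j nu * sigma j (x - y) * sigma j (e i) = 0.
    move=> i; rewrite -mE mD; apply/eqP; rewrite subr_eq0 -(inj_eq (addIr N%:R)).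
    by rewrite -!pE // pxy.
  by rewrite mulf_eq0 (gt_eqF (nu_pos _)) /= fmorph_eq0 subr_eq0 => /eqP.
by exists s => x xO xB; apply: sP.
Qed.

(** [M] is multiplication by [u] in the basis [e], diagonalized by [E], so the product of the
    conjugates is the rational number det M. It is also integral, hence a nonzero rational
    integer. *)
Lemma integers_norm_ge1 (R : realType) (F : fieldExtType rat) (n : nat)
    (sigma : 'I_n -> {rmorphism F -> R}) (u : F) :
  \dim {:F} = n -> (forall i j, sigma i =1 sigma j -> i = j) ->
  integers u -> u != 0 -> 1 <= \prod_j `|sigma j u|.
Proof.
move=> degF sigmaI uO u0.
have [e [eO eP]] := integral_basis degF.
pose E := \matrix_(i, j) sigma j (e i).
have E0 : \det E != 0.
  rewrite -det_tr; apply/det0P => -[v v0 vE]; move/eqP: v0; apply.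
  apply/rowP => j; rewrite mxE; move: j.
  apply: (separating_basis sigmaI eP) => i.
  move/rowP: vE => /(_ i); rewrite !mxE => vE; rewrite -[RHS]vE.
  by apply: eq_bigr => j _; rewrite !mxE.
have [q qP] := choice (fun i => eP (u * e i)).
pose M := \matrix_(i, l) q i l.
have ME : map_mx ratr M *m E = E *m diag_mx (\row_j sigma j u).
  apply/matrixP => i j; rewrite mul_mx_diag !mxE -rmorphM mulrC qP rmorph_sum.
  by apply: eq_bigr => l _; rewrite rmorph_scale !mxE.
have prodE : \prod_j sigma j u = ratr (\det M).
  have := congr1 determinant ME; rewrite !det_mulmx det_map_mx det_diag mulrC.
  by move/(mulfI E0) => ->; apply: eq_bigr => j _; rewrite mxE.
have intM : \det M \is a Num.int.
  apply: integral_rat.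
  have [p p_mon pP] : integralOver (intr : int -> R) (ratr (\det M)).
    rewrite -prodE; elim/big_ind : _ => [||j _]; [exact: integral1|exact: integral_mul|].
    have [p p_mon pu] := uO; exists p => //.
    rewrite (eq_map_poly (g := sigma j \o intr)) ?map_poly_comp ?fmorph_root //.
    by move=> x /=; rewrite rmorph_int.
  exists p => //; move: pP.
  rewrite (eq_map_poly (g := ratr \o intr)) ?map_poly_comp ?fmorph_root //.
  by move=> x /=; rewrite ratr_int.
rewrite -normr_prod prodE; case/intrP: intM => d dE.
have : ratr (\det M) != 0 :> R.
  by rewrite -prodE prodf_seq_neq0; apply/allP => j _; rewrite fmorph_eq0.
rewrite dE ratr_int -intr_norm ler1z intr_eq0 => d0.
by rewrite -gtz0_ge1 normr_gt0.
Qed.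

(* Some nonzero rational integer d is a multiple of g, so every integer is congruent
   modulo I to one whose coordinates, hence conjugates, are bounded in terms of d. *)
Lemma ideal_norm_bound (R : realType) (F : fieldExtType rat) (n : nat)
    (sigma : 'I_n -> {rmorphism F -> R}) (nu g : F) :
  \dim {:F} = n -> (forall i j, sigma i =1 sigma j -> i = j) ->
  dual_integers sigma nu -> totally_positive sigma nu -> g != 0 ->
  exists b : nat, forall I : set F, integral_ideal I -> I g -> (ideal_norm I <= b)%N.
Proof.
move=> degF sigmaI nu_dual nu_pos g0.
have [d [d0 dO]] := integers_denominator g^-1.
have [e [eO eP]] := integral_basis degF.
pose B : R := \sum_j \sum_i `|d%:~R| * `|sigma j (e i)|.
have [s sP] := box_finite B degF sigmaI nu_dual nu_pos.
exists (size s) => I [IO I0 ID IM] Ig.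
have Id a : integers a -> I (a * d%:~R).
  by move=> aO; rewrite -(divfK g0 d%:~R) mulrA; apply: IM => //; exact: integersM.
have IN x : I x -> I (- x).
  by move=> Ix; rewrite -mulN1r; apply: IM => //; exact: (@integers_int F (-1)).
pose c (x : F) : set F := [set x + a | a in I].
have cE x y : I (x - y) -> c x = c y.
  have sub u v : I (u - v) -> c u `<=` c v.
    move=> Iuv _ [a Ia <-]; exists (u - v + a); first exact: ID.
    by rewrite addrA [v + _]addrC subrK.
  by move=> Ixy; apply/seteqP; split; apply: sub => //; rewrite -opprB; exact: IN.
have csub : ideal_cosets I `<=` [set` map c s].
  move=> _ [x xO <-]; have [q qE] := eP x.
  (* [y] is [x] with its coordinates reduced modulo [d], so they are at most |d| in absolute
     value. *)
  pose f i := Num.floor (q i / d%:~R); pose y := \sum_i (q i - (f i)%:~R * d%:~R) *: e i.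
  have xyE : x - y = (\sum_i (f i)%:~R * e i) * d%:~R.
    rewrite qE -sumrB mulr_suml; apply: eq_bigr => i _.
    by rewrite -scalerBl subKr -scalerA !scaler_int mulrzl mulrzr mulrzAC.
  have Ixy : I (x - y).
    by rewrite xyE; apply: Id; apply: integers_sum => i; apply: integersM => //; exact: integers_int.
  rewrite /= -[X in X \in _]/(c x) (cE x y Ixy); apply: map_f; apply: sP.
    have -> : y = x - (x - y) by rewrite subKr.
    by apply: integersD => //; apply: integersN; exact: IO.
  move=> j; rewrite /B (bigD1 j) //=; apply: ler_wpDr.
    by apply: sumr_ge0 => *; apply: sumr_ge0 => *; apply: mulr_ge0.
  rewrite rmorph_sum; apply: le_trans (ler_norm_sum _ _ _) _; apply: ler_sum => i _.
  rewrite rmorph_scale normrM; apply: ler_wpM2r => //.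
  rewrite -(ratr_int R d) -!ratr_norm ler_rat.
  have d0' : d%:~R != 0 :> rat by rewrite intr_eq0.
  rewrite -[q i in X in X <= _](divfK d0') -mulrBl normrM ler_piMl //.
  rewrite ger0_norm ?subr_ge0 ?floor_le_tmp // lerBlDl.
  by rewrite ltW // -[1]/(1%:~R) -intrD floorD1_gt.
(* Finiteness comes first, as [fset_set] of an infinite set is empty. *)
have fin : finite_set (ideal_cosets I) by apply: sub_finite_set csub _; exact: finite_seq.
rewrite /ideal_norm -(size_map c s); apply: uniq_leq_size; first exact: fset_uniq.
by move=> C; rewrite in_fset_set // inE => /csub.
Qed.

(** * The gap above n for sums of squared conjugates *)

(** The cap [c <= 1] serves [unit_gap] for elements with sum of squares at least n + 1, which are
    treated apart from the list. *)
Lemma finite_positive_lower_bound (R : realType) (T : eqType) (f : T -> R) (s : seq T) :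
  exists c, [/\ 0 < c, c <= 1 & forall x, x \in s -> 0 < f x -> c <= f x].
Proof.
elim: s => [|a s [c [c0 c1 cP]]]; first by exists 1.
exists (if 0 < f a then Num.min c (f a) else c); split.
- by case: ifP => // fa; rewrite lt_min c0 fa.
- by case: ifP => // fa; rewrite ge_min c1.
- move=> x; rewrite in_cons => /predU1P[->|xs] fx; first by rewrite fx ge_min lexx orbT.
  by case: ifP => _; rewrite ?ge_min cP.
Qed.

(** Sums of squares below n + 1 come from finitely many integers, so it is enough that each excess
    over n is positive. *)
Lemma unit_gap (R : realType) (F : fieldExtType rat) (n : nat)
    (sigma : 'I_n -> {rmorphism F -> R}) (nu : F) :
  \dim {:F} = n -> (forall i j, sigma i =1 sigma j -> i = j) ->
  dual_integers sigma nu -> totally_positive sigma nu ->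
  exists2 c : R, 0 < c & forall u, integers u -> u != 0 -> u != 1 -> u != -1 ->
    n%:R + c <= \sum_j sigma j u ^+ 2.
Proof.
move=> degF sigmaI nu_dual nu_pos; have n_gt0 := degree_gt0 degF.
pose f u : R := \sum_j sigma j u ^+ 2 - n%:R.
have [s sP] := box_finite (n%:R + 1) degF sigmaI nu_dual nu_pos.
have [c [c0 c1 cP]] := finite_positive_lower_bound f s.
exists c => // u uO u0 u1 uN1.
have [big|small] := leP (n%:R + 1) (\sum_j sigma j u ^+ 2).
  by apply: le_trans big; rewrite lerD2l.
rewrite -lerBrDl; apply: cP.
  apply: sP => // j; rewrite -[leRHS]ger0_norm; last by rewrite ler_wpDl.
  rewrite -ler_sqr ?nnegrE // !real_normK ?num_real //.
  apply: (@le_trans _ _ (n%:R + 1)).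
    apply: le_trans (ltW small); rewrite (bigD1 j) //= lerDl.
    by apply: sumr_ge0 => *; exact: sqr_ge0.
  by rewrite ler_eXnr // lerDr.
rewrite subr_gt0 ltNge; apply/negP => le_n.
(* Arithmetic-geometric mean via a * exp(1 - a) <= 1, with equality only at a = 1: a norm at least 1
   and a sum at most n force every squared conjugate to be 1. *)
pose b j : R := sigma j u ^+ 2 * expR (1 - sigma j u ^+ 2).
have b_ge0 j : 0 <= b j by rewrite mulr_ge0 ?sqr_ge0 ?expR_ge0.
have expge j : sigma j u ^+ 2 <= expR (sigma j u ^+ 2 - 1).
  by apply: le_trans (expR_ge1Dx _); rewrite addrC subrK.
have bE j : b j = sigma j u ^+ 2 / expR (sigma j u ^+ 2 - 1) by rewrite /b -expRN opprB.
have b_le1 j : b j <= 1 by rewrite bE ler_pdivrMr ?expR_gt0 // mul1r.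
have prod_b : 1 <= \prod_j b j.
  rewrite big_split /= -expR_sum -[leLHS]mul1r; apply: ler_pM => //.
    rewrite prodrXl -real_normK ?num_real // normr_prod.
    by rewrite exprn_ege1 // (integers_norm_ge1 degF).
  by rewrite -[leLHS]expR0 ler_expR sumrB sumr_const card_ord subr_ge0.
have sq1 j : sigma j u ^+ 2 = 1.
  apply/eqP; apply: contraT => aj.
  have : b j < 1.
    rewrite bE ltr_pdivrMr ?expR_gt0 // mul1r.
    by apply: le_lt_trans (expR_gt1Dx _); rewrite ?subr_eq0 // addrC subrK.
  move/lt_le_trans => /(_ _ prod_b); rewrite ltNge (bigD1 j) //= ler_piMr //.
  by apply: prodr_ile1 => i _; rewrite b_ge0 b_le1.
have /eqP := sq1 (Ordinal n_gt0); rewrite -rmorphXn fmorph_eq1 sqrf_eq1.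
by rewrite (negPf u1) (negPf uN1).
Qed.

(** * Summable weights on the integers of [F] *)

(* (1 + |x|)^(-3/2): since k_j >= 3, one such factor is available for each of the
   entries gamma and delta, and the exponent still exceeds 1. *)
Definition weight (R : realType) (x : R) : R := Num.sqrt (1 + `|x|) ^- 3.

Lemma weight_gt0 (R : realType) (x : R) : 0 < weight x.
Proof. by rewrite invr_gt0 exprn_gt0 // sqrtr_gt0 ltr_pwDl. Qed.

Lemma weight_le (R : realType) (x y : R) : `|x| <= `|y| -> weight y <= weight x.
Proof.
move=> xy; rewrite lef_pV2 ?posrE ?exprn_gt0 ?sqrtr_gt0 ?ltr_pwDl //.
by rewrite lerXn2r ?nnegrE ?sqrtr_ge0 // ler_wsqrtr // lerD2l.
Qed.

Lemma weight_series (R : realType) (N : nat) :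
  \sum_(i < N) weight i%:R <= 3 :> R.
Proof.
(* Comparison with the integral of x^(-3/2): the bound is 1 + (2 - 2 / sqrt(N + 1)). *)
suff H : \sum_(i < N.+1) weight i%:R <= 3 - 2 / Num.sqrt N.+1%:R :> R.
  apply: (@le_trans _ _ (\sum_(i < N.+1) (weight i%:R : R))).
    by rewrite big_ord_recr /= lerDl ltW // weight_gt0.
  by apply: le_trans H _; rewrite gerBl divr_ge0 // sqrtr_ge0.
elim: N => [|N IH].
  by rewrite big_ord_recl big_ord0 addr0 /weight normr0 addr0 sqrtr1 expr1n invr1; lra.
rewrite big_ord_recr /=; apply: le_trans (lerD IH (lexx _)) _.
rewrite /weight normr_nat nat1r.
set r := Num.sqrt N.+1%:R; set s := Num.sqrt N.+2%:R.
have r0 : 0 < r by rewrite sqrtr_gt0 ltr0n.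
have s0 : 0 < s by rewrite sqrtr_gt0 ltr0n.
have r2 : r ^+ 2 = N.+1%:R by rewrite sqr_sqrtr.
have s2 : s ^+ 2 = r ^+ 2 + 1 by rewrite r2 sqr_sqrtr // [in LHS]mulrSr.
have rs : r <= s by rewrite ler_wsqrtr // ler_nat.
(* Both follow from (s - r) * (s + r) = 1 and r <= s. *)
have h1 : 1 <= 2 * s * (s - r) by nra.
have h2 : r <= 2 * s ^+ 2 * (s - r) by nra.
rewrite -subr_ge0.
have -> : 3 - 2 / s - (3 - 2 / r + s ^- 3) =
    (2 * s ^+ 2 * (s - r) - r) / (r * s ^+ 3).
  by field; rewrite ?gt_eqF.
by rewrite divr_ge0 ?subr_ge0 // mulr_ge0 ?exprn_ge0 // ltW.
Qed.

(* Integers whose conjugates have the same signs and integral parts differ by one of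
   the finitely many integers in the unit box, so that the sum is controlled by one
   over n-tuples of pairs of a sign and a natural number. *)
Lemma lattice_sum_bound (R : realType) (F : fieldExtType rat) (n : nat)
    (sigma : 'I_n -> {rmorphism F -> R}) (nu : F) :
  \dim {:F} = n -> (forall i j, sigma i =1 sigma j -> i = j) ->
  dual_integers sigma nu -> totally_positive sigma nu ->
  exists K : R, forall s : seq F, uniq s -> (forall x, x \in s -> integers x) ->
    \sum_(x <- s) \prod_j weight (sigma j x) <= K.
Proof.
move=> degF sigmaI nu_dual nu_pos.
have [t tP] := box_finite 1 degF sigmaI nu_dual nu_pos.
(* Each coordinate gives two signs times the bound 3 of [weight_series]; [size t] bounds the number
   of integers in one cell. *)
exists ((size t)%:R * \prod_(j < n) 6) => s s_uniq sO.
pose a x j := Num.truncn `|sigma j x|.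
pose N := (\max_(x <- s) \max_j a x j)%N.
have aN x j : x \in s -> (a x j <= N)%N.
  move=> xs; apply: leq_trans (leq_bigmax (F := a x) j) _.
  exact: (leq_bigmax_seq (F := fun x => \max_j a x j)%N).
pose p x := [ffun j => (0 <= sigma j x, inord (a x j))] : {ffun 'I_n -> bool * 'I_N.+1}.
have pE x j : x \in s -> ((p x j).2 : nat) = a x j.
  by move=> xs; rewrite ffunE /= inordK // ltnS aN.
have aP x j : (a x j)%:R <= `|sigma j x| < (a x j).+1%:R by exact: truncn_itv.
rewrite (partition_big p predT) //=.
have -> : (size t)%:R * \prod_(j < n) 6 = \prod_(j < n) 6 *+ size t :> R.
  by rewrite mulr_natl.
apply: (@le_trans _ _ (\sum_(q : {ffun 'I_n -> bool * 'I_N.+1})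
    (\prod_j weight (q j).2%:R) *+ size t)).
  apply: ler_sum => q _.
  apply: (@le_trans _ _ (\sum_(x <- s | p x == q) \prod_j weight (q j).2%:R)).
    rewrite big_seq_cond [leRHS]big_seq_cond; apply: ler_sum => x /andP[xs /eqP <-].
    apply: ler_prod => j _; rewrite ltW ?weight_gt0 //= weight_le //.
    by rewrite pE // normr_nat; case/andP: (aP x j).
  rewrite big_const_seq iter_addr_0 -[leLHS]mulr_natr -[leRHS]mulr_natr.
  apply: ler_wpM2l; last first.
    rewrite ler_nat.
    rewrite -size_filter; case E : [seq x <- s | p x == q] => [//|x0 l].
    have xl x : x \in x0 :: l -> x \in s /\ p x = q.
      by rewrite -E mem_filter => /andP[/eqP].
    (* Translating by one member of the cell puts all of them in the unit box. *)
    rewrite -E -(size_map (fun x => x - x0)); apply: uniq_leq_size.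
      by rewrite map_inj_uniq ?filter_uniq //; exact: addIr.
    move=> _ /mapP[x + ->]; rewrite E => /xl[xs px].
    have [x0s px0] := xl x0 (mem_head _ _).
    apply: tP => [|j]; first by apply: integersD; [exact: sO|apply: integersN; exact: sO].
    have := congr1 (fun f : {ffun _} => f j) (etrans px (esym px0)).
    rewrite !ffunE => -[sg /(congr1 val) /=]; rewrite !inordK ?ltnS ?aN // => aE.
    move: (aP x j) (aP x0 j); rewrite aE rmorphB mulrS.
    case: (leP 0 (sigma j x)) sg => h1; case: (leP 0 (sigma j x0)) => h2 // _.
      by rewrite (ger0_norm h1) (ger0_norm h2) ler_norml; lra.
    by rewrite (ltr0_norm h1) (ltr0_norm h2) ler_norml; lra.
  by apply: prodr_ge0 => j _; rewrite ltW ?weight_gt0.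
rewrite sumrMnl; apply: ler_wMn2r.
rewrite -(bigA_distr_bigA (fun (j : 'I_n) (q : bool * 'I_N.+1) => weight q.2%:R)).
apply: ler_prod => j _; apply/andP; split.
  by apply: sumr_ge0 => q _; rewrite ltW ?weight_gt0.
rewrite -(pair_bigA _ (fun (_ : bool) (i : 'I_N.+1) => weight i%:R)) /=.
rewrite sumr_const card_bool -mulr_natr.
have := weight_series R N.+1; lra.
Qed.

(** * Unordered sums: tails, domination and nonvanishing *)

Lemma ler_sum_subset (R : realType) (T : eqType) (g : T -> R) (s1 s2 : seq T) :
  (forall x, 0 <= g x) -> uniq s1 -> {subset s1 <= s2} ->
  \sum_(x <- s1) g x <= \sum_(x <- s2) g x.
Proof.
move=> g0; elim: s1 s2 => [|a l IH] s2; first by rewrite big_nil sumr_ge0.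
move=> /= /andP[al ul] sub; have as2 := sub a (mem_head _ _).
rewrite (perm_big _ (perm_to_rem as2)) !big_cons lerD2l; apply: IH => // x xl.
have := sub x; rewrite (perm_mem (perm_to_rem as2)) !in_cons xl orbT => /(_ isT).
by case/predU1P => // xa; move: al; rewrite -xa xl.
Qed.

(** A list whose sum is within [e] of the supremum leaves at most [e] for any list disjoint from
    it. *)
Lemma sum_tail (R : realType) (T : eqType) (P : T -> Prop) (g : T -> R) (K e : R) :
  (forall s, uniq s -> (forall x, x \in s -> P x) -> \sum_(x <- s) g x <= K) ->
  0 < e ->
  exists s0 : seq T, forall s, uniq s -> (forall x, x \in s -> P x) ->
    (forall x, x \in s -> x \notin s0) -> \sum_(x <- s) g x <= e.
Proof.
move=> gK e0.
pose S := [set \sum_(x <- s) g x | s in [set s | uniq s /\ forall x, x \in s -> P x]].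
have S_sup : has_sup S.
  split; first by exists 0, [::]; rewrite ?big_nil.
  by exists K => _ [s [us sP] <-]; exact: gK.
have [_ [s0 [us0 s0P] <-] s0e] := sup_adherent e0 S_sup.
exists s0 => s us sP ss0.
have : \sum_(x <- s0 ++ s) g x <= sup S.
  apply: sup_upper_bound => //; exists (s0 ++ s) => //; split.
    rewrite cat_uniq us0 us andbT; apply/hasPn => x xs; exact: ss0.
  by move=> x; rewrite mem_cat => /orP[/s0P|/sP].
rewrite big_cat /=; lra.
Qed.

Lemma partial_sumE (R : zmodType) (T : choiceType) (f : T -> R) (A : {fset T}) :
  summability.partial_sum f A = \sum_(x <- A) f x.
Proof. by rewrite /summability.partial_sum -(big_seq_fsetE _ _ predT f). Qed.

(** Finite sums grow with the subset, so their supremum is the limit. *)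
Lemma nneg_partial_sum_cvg (R : realType) (T : choiceType) (h : T -> R) (K : R) :
  (forall x, 0 <= h x) -> (forall A : {fset T}, \sum_(x <- A) h x <= K) ->
  exists l : R, forall e, 0 < e -> exists A0 : {fset T}, forall A : {fset T},
    (A0 `<=` A)%fset -> `|l - \sum_(x <- A) h x| < e.
Proof.
move=> h0 hK; pose S := range (fun A : {fset T} => \sum_(x <- A) h x).
have S_sup : has_sup S.
  by split; [exists (\sum_(x <- (fset0 : {fset T})) h x), fset0|exists K => _ [A _ <-]].
exists (sup S) => e e0; have [_ [A0 _ <-] A0e] := sup_adherent e0 S_sup.
exists A0 => A /fsubsetP A0A.
have h1 : \sum_(x <- A) h x <= sup S by apply: sup_upper_bound => //; exists A.
have h2 : \sum_(x <- A0) h x <= \sum_(x <- A) h x by apply: ler_sum_subset.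
by rewrite ltr_norml; lra.
Qed.

(** [u] is the difference of the nonnegative families [g + u] and [g]. *)
Lemma dominated_partial_sum_cvg (R : realType) (T : choiceType) (u g : T -> R) (K : R) :
  (forall x, `|u x| <= g x) -> (forall A : {fset T}, \sum_(x <- A) g x <= K) ->
  exists l : R, forall e, 0 < e -> exists A0 : {fset T}, forall A : {fset T},
    (A0 `<=` A)%fset -> `|l - \sum_(x <- A) u x| < e.
Proof.
move=> ug gK.
have g0 x : 0 <= g x by apply: le_trans (ug x).
have [l1 l1P] := nneg_partial_sum_cvg g0 gK.
have [||l2 l2P] := @nneg_partial_sum_cvg R T (fun x => g x + u x) (K + K).
- by move=> x; have := ug x; rewrite ler_norml; lra.
- move=> A; rewrite big_split /=; apply: lerD => //; apply: le_trans (gK A).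
  by apply: ler_sum => x _; apply: le_trans (ug x); exact: ler_norm.
exists (l2 - l1) => e e0.
have [A1 A1P] := l1P _ (divr_gt0 e0 (ltr0Sn R 1)).
have [A2 A2P] := l2P _ (divr_gt0 e0 (ltr0Sn R 1)).
exists (A1 `|` A2)%fset => A; rewrite fsubUset => /andP[/A1P + /A2P].
by rewrite big_split /= !ltr_norml; lra.
Qed.

Lemma norm_complex_le (R : realType) (x : R[i]) :
  `|x| <= (`|complex.Re x| + `|complex.Im x|)%:C.
Proof.
rewrite normc_def lecR -[leRHS]ger0_norm ?addr_ge0 // -sqrtr_sqr ler_wsqrtr //.
rewrite sqrrD !real_normK ?num_real // lerD2r lerDl mulrn_wge0 //.
Qed.

Lemma norm_complex_ge_Im (R : realType) (x : R[i]) : `|complex.Im x|%:C <= `|x|.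
Proof. by rewrite normc_def lecR -sqrtr_sqr ler_wsqrtr // lerDr sqr_ge0. Qed.

Lemma Re_sum (R : realType) (T : Type) (s : seq T) (f : T -> R[i]) :
  complex.Re (\sum_(x <- s) f x) = \sum_(x <- s) complex.Re (f x).
Proof. by apply: (big_morph (@complex.Re R)) => // -[a b] [c d]. Qed.

Lemma Im_sum (R : realType) (T : Type) (s : seq T) (f : T -> R[i]) :
  complex.Im (\sum_(x <- s) f x) = \sum_(x <- s) complex.Im (f x).
Proof. by apply: (big_morph (@complex.Im R)) => // -[a b] [c d]. Qed.

Lemma dominated_complex_sum_cvg (R : realType) (T : choiceType) (f : T -> R[i])
    (g : T -> R) (K : R) :
  (forall x, `|f x| <= (g x)%:C) -> (forall A : {fset T}, \sum_(x <- A) g x <= K) ->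
  exists l : R[i]^o,
    (summability.partial_sum f : {fset T} -> R[i]^o) @ summability.totally --> l.
Proof.
move=> fg gK.
have Refg x : `|complex.Re (f x)| <= g x.
  by rewrite -lecR; apply: le_trans (fg x); exact: normc_ge_Re.
have Imfg x : `|complex.Im (f x)| <= g x.
  by rewrite -lecR; apply: le_trans (fg x); exact: norm_complex_ge_Im.
have [l1 l1P] := dominated_partial_sum_cvg Refg gK.
have [l2 l2P] := dominated_partial_sum_cvg Imfg gK.
exists (l1 +i* l2).
have FF := @summability.totally_filter T.
(* A positive element of [R[i]] is a positive real, so [e] can be halved between real and imaginary
   parts. *)
apply/cvgrPdist_lt => /= e; rewrite ltcE /= => /andP[/eqP Ime e0].
have [A1 A1P] := l1P _ (divr_gt0 e0 (ltr0Sn R 1)).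
have [A2 A2P] := l2P _ (divr_gt0 e0 (ltr0Sn R 1)).
exists (A1 `|` A2)%fset => // A /=; rewrite fsubUset => /andP[/A1P h1 /A2P h2].
rewrite partial_sumE; apply: le_lt_trans (norm_complex_le _) _.
rewrite ltcE /= Ime eqxx /=.
have -> : complex.Re (l1 +i* l2 - \sum_(x <- A) f x) =
    l1 - \sum_(x <- A) complex.Re (f x) by rewrite -Re_sum; case: (\sum_(x <- A) f x).
have -> : complex.Im (l1 +i* l2 - \sum_(x <- A) f x) =
    l2 - \sum_(x <- A) complex.Im (f x) by rewrite -Im_sum; case: (\sum_(x <- A) f x).
by move: h1 h2; set u := `|_|; set w := `|_|; lra.
Qed.

(** As [summability.sum] is 0 without convergence, domination by [g] first yields a genuine limit.
    Finite sums containing both [a] and [b] then have absolute value at least [v - e]. *)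
Lemma sum_neq0 (R : realType) (T : choiceType) (f : T -> R[i]) (g : T -> R)
    (a b : T) (v e : R) :
  a != b -> f a + f b = v%:C ->
  (forall x, `|f x| <= (g x)%:C) ->
  (forall s : seq T, uniq s -> a \notin s -> b \notin s -> \sum_(x <- s) g x <= e) ->
  e < v -> summability.sum (f : T -> R[i]^o) <> 0.
Proof.
move=> ab fab fg ge ev.
have g0 x : 0 <= g x.
  by move: (le_trans (normr_ge0 (f x)) (fg x)); rewrite lecE /= => /andP[].
have gK (A : {fset T}) : \sum_(x <- A) g x <= g a + (g b + e).
  pose l := [seq x <- (A : seq T) | (x != a) && (x != b)].
  apply: (@le_trans _ _ (\sum_(x <- [:: a, b & l]) g x)).
    apply: ler_sum_subset => // x xA; rewrite !in_cons mem_filter xA andbT.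
    by case: eqP => //= _; case: eqP.
  rewrite !big_cons !lerD2l; apply: ge; first by rewrite filter_uniq.
    by rewrite mem_filter eqxx.
  by rewrite mem_filter eqxx andbF.
have [l fl] := dominated_complex_sum_cvg fg gK.
have FF := @summability.totally_filter T.
have -> : summability.sum (f : T -> R[i]^o) = l.
  by apply: cvg_lim fl; exact: norm_hausdorff.
move=> l0; move: fl; rewrite l0 => /cvgrPdist_lt /(_ (v - e)%:C).
rewrite ltcR subr_gt0 => /(_ ev) [A0 _ /(_ (A0 `|` [fset a; b])%fset)] /=.
rewrite fsubsetUl => /(_ isT); set A := (A0 `|` _)%fset.
have aA : a \in A by rewrite !inE eqxx orbT.
have bA : b \in (A `\ a)%fset by rewrite !inE eq_sym ab eqxx !orbT.
rewrite sub0r normrN partial_sumE (big_fsetD1 a) //= (big_fsetD1 b) //= addrA fab.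
set B := ((A `\ a) `\ b)%fset.
have restB : `|\sum_(x <- B) f x| <= e%:C.
  apply: le_trans (ler_norm_sum _ _ _) _.
  apply: (@le_trans _ _ (\sum_(x <- B) g x)%:C).
    by rewrite rmorph_sum; apply: ler_sum => x _; exact: fg.
  by rewrite lecR; apply: ge => //; rewrite !inE eqxx // andbF.
move=> small.
have vE : v%:C <= `|v%:C| by rewrite normc_def lecR /= expr0n addr0 sqrtr_sqr ler_norm.
suff : v%:C < v%:C by rewrite ltxx.
apply: le_lt_trans vE _.
rewrite -[v%:C](addrK (\sum_(x <- B) f x)); apply: le_lt_trans (ler_normB _ _) _.
apply: lt_le_trans (ltr_leD small restB) _.
by rewrite addrK -rmorphD /= subrK.
Qed.

(** * The factor of a term at one embedding *)

(** [r] is |g i y + d|. Both |g| and |d| are at most r / m with m = min(y, 1), so the product of the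
    weights is at least (m / (1 + r))^3, and it remains to compare the factor with (1 + r)^(-3). *)
Lemma term_bound (R : realType) (y c : R) (k : nat) : 0 < y -> 0 < c -> (2 < k)%N ->
  exists2 C : R, 0 < C & forall g d r : R, 0 < r -> r ^+ 2 = (g * y) ^+ 2 + d ^+ 2 ->
    r ^- k * expR (- (c / r ^+ 2)) <= C * (weight g * weight d).
Proof.
move=> y0 c0 k2; pose m := Num.min y 1.
have m0 : 0 < m by rewrite lt_min y0 ltr01.
(* (k / c)^k bounds the factor for r <= 1, and the summand 1 covers r > 1. The 2 in the constant is
   there because 2 / (1 + r) is at least 1 in the first case and at least 1 / r in the second. *)
pose D : R := 1 + (k%:R / c) ^+ k.
have q0 : 0 <= (k%:R / c) ^+ k by rewrite exprn_ge0 // divr_ge0 // ltW.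
have D1 : 1 <= D by rewrite lerDl.
have D0 : 0 < D by apply: lt_le_trans D1.
(* For r <= 1, exp x >= (x / k)^k absorbs the pole. *)
exists (D * (2 / m) ^+ 3); first by rewrite mulr_gt0 // exprn_gt0 // divr_gt0.
move=> g d r r0 rE.
have w_ge : (m / (1 + r)) ^+ 3 <= weight g * weight d.
  have gr : `|g| <= r / m.
    rewrite ler_pdivlMr // -ler_sqr ?nnegrE ?mulr_ge0 ?(ltW m0) ?(ltW r0) // exprMn real_normK ?num_real //.
    rewrite rE exprMn; apply: le_trans (_ : g ^+ 2 * y ^+ 2 <= _); last by rewrite lerDl sqr_ge0.
    rewrite ler_wpM2l ?sqr_ge0 // lerXn2r ?nnegrE ?(ltW m0) ?(ltW y0) // ge_min lexx //.
  have dr : `|d| <= r / m.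
    apply: (@le_trans _ _ r).
      rewrite -ler_sqr ?nnegrE ?(ltW r0) // real_normK ?num_real // rE lerDr sqr_ge0 //.
    by rewrite ler_pdivlMr // ler_piMr ?(ltW r0) // ge_min lexx orbT.
  have rm : 1 + r / m <= (1 + r) / m.
    by rewrite mulrDl lerD2r mul1r invf_ge1 // ge_min lexx orbT.
  rewrite /weight -invfM -exprMn -sqrtrM ?addr_ge0 // -[m / _]invrK exprVn.
  rewrite lef_pV2 ?posrE ?exprn_gt0 ?sqrtr_gt0 ?mulr_gt0 ?ltr_pwDl ?invr_gt0 ?divr_gt0 ?addr_gt0 //.
  rewrite lerXn2r ?nnegrE ?sqrtr_ge0 ?invr_ge0 ?divr_ge0 ?addr_ge0 ?(ltW m0) ?(ltW r0) //.
  rewrite invf_div; apply: le_trans rm.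
  have r1 : 0 <= 1 + r / m by rewrite addr_ge0 ?divr_ge0 ?(ltW m0) ?(ltW r0).
  rewrite -[leRHS](ger0_norm r1) -(sqrtr_sqr (1 + r / m)) ler_wsqrtr // expr2.
  by apply: ler_pM; rewrite ?addr_ge0 // lerD2l.
apply: (@le_trans _ _ (D * (2 / m) ^+ 3 * (m / (1 + r)) ^+ 3)); last first.
  by rewrite ler_wpM2l // mulr_ge0 ?(ltW D0) // exprn_ge0 // divr_ge0 // ltW.
have r10 : 0 < 1 + r by rewrite addr_gt0.
rewrite -mulrA -exprMn (_ : 2 / m * (m / (1 + r)) = 2 / (1 + r)); last first.
  by field; rewrite !gt_eqF.
have [r1|r1] := leP r 1.
  apply: (@le_trans _ _ D); last first.
    by rewrite ler_peMr ?(ltW D0) // exprn_ege1 // ler_pdivlMr // mul1r; lra.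
  apply: (@le_trans _ _ ((k%:R / c) ^+ k)); last by rewrite lerDr.
  have k0 : 0 < k%:R :> R by rewrite ltr0n; apply: leq_trans k2.
  have h1 : (c / (k%:R * r ^+ 2)) ^+ k <= expR (c / r ^+ 2).
    have -> : c / r ^+ 2 = c / (k%:R * r ^+ 2) * k%:R by field; rewrite !gt_eqF.
    rewrite expRM_natr.
    apply: lerXn2r; rewrite ?nnegrE ?expR_ge0 ?divr_ge0 ?mulr_ge0 ?exprn_ge0 ?(ltW c0) ?(ltW r0) //.
    by apply: le_trans (expR_ge1Dx _); rewrite lerDr.
  rewrite expRN -invfM -[leRHS]invrK -exprVn invf_div.
  rewrite lef_pV2 ?posrE ?mulr_gt0 ?expR_gt0 ?exprn_gt0 ?divr_gt0 //.
  apply: (@le_trans _ _ (r ^+ k * (c / (k%:R * r ^+ 2)) ^+ k)); last first.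
    by rewrite ler_wpM2l // exprn_ge0 // ltW.
  rewrite -exprMn lerXn2r ?nnegrE ?mulr_ge0 ?divr_ge0 ?invr_ge0 ?mulr_ge0 ?exprn_ge0 ?(ltW c0) ?(ltW r0) //.
  have -> : r * (c / (k%:R * r ^+ 2)) = c / k%:R / r by field; rewrite !gt_eqF.
  by rewrite ler_pdivlMr // ler_piMr // divr_ge0 // ltW.
have e1 : expR (- (c / r ^+ 2)) <= 1.
  by rewrite -expR0 ler_expR oppr_le0 divr_ge0 ?exprn_ge0 // ltW.
apply: (@le_trans _ _ (r ^- k)).
  by rewrite ler_piMr // invr_ge0 exprn_ge0 // ltW.
apply: (@le_trans _ _ (r ^- 3)).
  rewrite lef_pV2 ?posrE ?exprn_gt0 //; exact: ler_weXn2l (ltW r1) _ _ k2.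
apply: (@le_trans _ _ ((2 / (1 + r)) ^+ 3)); last first.
  by rewrite ler_peMl // exprn_ge0 // divr_ge0 // ltW.
rewrite -[leRHS]invrK -exprVn invf_div lef_pV2 ?posrE ?exprn_gt0 ?divr_gt0 //.
rewrite lerXn2r ?nnegrE ?divr_ge0 ?(ltW r10) ?(ltW r0) //; lra.
Qed.

(** * Cosets of [Gamma_inf] and their bottom rows *)

Lemma mulmx2E (F : fieldType) (A B : 'M[F]_2) i j :
  (A *m B) i j = A i 0 * B 0 j + A i 1 * B 1 j.
Proof.
have l1 : lift ord0 ord0 = 1 :> 'I_2 by apply: val_inj.
by rewrite mxE !big_ord_recl big_ord0 addr0 l1.
Qed.

Lemma ord2P (l : 'I_2) : l = 0 \/ l = 1.
Proof. by case: l => -[|[|//]] l; [left|right]; apply: val_inj. Qed.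

Lemma matrix2P (F : fieldType) (A B : 'M[F]_2) :
  A 0 0 = B 0 0 -> A 0 1 = B 0 1 -> A 1 0 = B 1 0 -> A 1 1 = B 1 1 -> A = B.
Proof.
move=> h00 h01 h10 h11; apply/matrixP => i j.
by case: (ord2P i) => ->; case: (ord2P j) => ->.
Qed.

Lemma Gamma_inf_mul (F : fieldExtType rat) (U V : 'M[F]_2) :
  Gamma_inf U -> Gamma_inf V -> Gamma_inf (U *m V).
Proof.
move=> [U00 U10 U11 U01] [V00 V10 V11 V01]; split; rewrite mulmx2E.
- by rewrite U00 V00 V10 mulr0 addr0 mulr1.
- by rewrite U10 V10 mul0r mulr0 addr0.
- by rewrite U10 U11 V11 mul0r mulr1 add0r.
- by rewrite U00 V11 mul1r mulr1; exact: integersD.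
Qed.

Lemma Gamma_inf_inv (F : fieldExtType rat) (U : 'M[F]_2) :
  Gamma_inf U -> exists2 V, Gamma_inf V & V *m U = 1%:M.
Proof.
move=> [U00 U10 U11 U01].
exists (\matrix_(i, j) if (i == 0) && (j == 1) then - U 0 1 else (i == j)%:R).
  by split; rewrite mxE //=; exact: integersN.
by apply: matrix2P; rewrite mulmx2E !mxE ?U00 ?U10 ?U11 /=; ring.
Qed.

Lemma coset_inf_mul (F : fieldExtType rat) (U M : 'M[F]_2) :
  Gamma_inf U -> coset_inf (U *m M) = coset_inf M.
Proof.
move=> UP; have [V VP VU] := Gamma_inf_inv UP.
apply/seteqP; split=> [_ [W WP <-]|_ [W WP <-]].
  by exists (W *m U); [exact: Gamma_inf_mul|rewrite mulmxA].
exists (W *m V); first exact: Gamma_inf_mul.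
by rewrite mulmxA -[W *m V *m U]mulmxA VU mulmx1.
Qed.

(** Equal bottom rows make [M] times the inverse of [N] upper unipotent; [U] is this product,
    expanded through the adjugate of [N]. *)
Lemma coset_inf_bottom_row (F : fieldExtType rat) (M N : 'M[F]_2) :
  SL2_integers M -> SL2_integers N -> M 1 0 = N 1 0 -> M 1 1 = N 1 1 ->
  coset_inf M = coset_inf N.
Proof.
move=> [MO + ] [NO +] e0 e1; rewrite !det2 e0 e1 => dM dN.
pose U := \matrix_(i < 2, j < 2) if (i == 0) && (j == 1)
  then M 0 1 * N 0 0 - M 0 0 * N 0 1 else (i == j)%:R.
have -> : M = U *m N.
  apply: matrix2P; rewrite mulmx2E !mxE /= ?e0 ?e1 ?mul0r ?mul1r ?add0r //.
  - transitivity (M 0 0 * (N 0 0 * N 1 1 - N 0 1 * N 1 0) +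
      N 0 0 * (1 - (M 0 0 * N 1 1 - M 0 1 * N 1 0))); last by ring.
    by rewrite dM dN; ring.
  - transitivity (M 0 1 * (N 0 0 * N 1 1 - N 0 1 * N 1 0) +
      N 0 1 * (1 - (M 0 0 * N 1 1 - M 0 1 * N 1 0))); last by ring.
    by rewrite dM dN; ring.
apply: coset_inf_mul; split; rewrite mxE //=.
by apply: integersD; [|apply: integersN]; apply: integersM.
Qed.

Lemma Gamma_inf1 (F : fieldExtType rat) : @Gamma_inf F 1%:M.
Proof. by split; rewrite mxE //; exact: (@integers_int F 0). Qed.

Lemma coset_inf_refl (F : fieldExtType rat) (M : 'M[F]_2) : coset_inf M M.
Proof. by exists 1%:M; [exact: Gamma_inf1|rewrite mul1mx]. Qed.

Lemma coset_inf_rep (F : fieldExtType rat) (I : set F) (C : set 'M[F]_2) :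
  quotient_inf I C -> Gamma0 I (xget 0 C) /\ coset_inf (xget 0 C) = C.
Proof.
move=> [M [[MO dM] MI] <-].
have [U UP <-] : coset_inf M (xget 0 (coset_inf M)).
  by apply: xgetPex; exists M; exact: coset_inf_refl.
split; last exact: coset_inf_mul.
have [U00 U10 U11 U01] := UP; split; last by rewrite mulmx2E U10 U11 mul0r add0r mul1r.
split; last by rewrite det_mulmx dM det2 U00 U11 U10 mulr0 subr0 !mulr1.
have UO i j : integers (U i j).
  have int1 : integers (1 : F) := @integers_int F 1.
  have int0 : integers (0 : F) := @integers_int F 0.
  by case: (ord2P i) => ->; case: (ord2P j) => ->; rewrite ?U00 ?U10 ?U11.
by move=> i j; rewrite mulmx2E; apply: integersD; apply: integersM.
Qed.


(** * Absolute values of the terms at a purely imaginary point *)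

(** For [c] = 2 pi t and nu_j y_j = t, the absolute value at z = i y of a term with bottom row [p];
    [r] is |gamma_j z_j + delta_j|. *)
Definition term_norm (R : realType) (F : fieldExtType rat) (n : nat)
    (sigma : 'I_n -> {rmorphism F -> R}) (k : 'I_n -> nat) (c : R) (y : 'I_n -> R)
    (p : F * F) : R :=
  \prod_j (let r := Num.sqrt ((sigma j p.1 * y j) ^+ 2 + sigma j p.2 ^+ 2) in
           r ^- k j * expR (- (c / r ^+ 2))).

Lemma norm_cexp (R : realType) (w : R[i]) : `|cexp w| = (expR (complex.Re w))%:C.
Proof.
rewrite /cexp normrM normc_def normc_def /= expr0n addr0 sqrtr_sqr cos2Dsin2 sqrtr1 mulr1.
by rewrite ger0_norm // expR_ge0.
Qed.

Lemma Im_moebius_imaginary (R : realType) (a b c d y : R) :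
  complex.Im ((a%:C * (0 +i* y) + b%:C) / (c%:C * (0 +i* y) + d%:C)) =
  (a * d - b * c) * y / ((c * y) ^+ 2 + d ^+ 2).
Proof.
rewrite /=.
have -> : (c * 0 - 0 * y + d) ^+ 2 + (c * y + 0 * 0 + 0) ^+ 2 = (c * y) ^+ 2 + d ^+ 2 by ring.
by ring.
Qed.

(** The imaginary part of (M z)_j is y_j / r_j^2; as nu_j y_j = t for all j, it contributes -2 pi t
    / r_j^2 to the exponent. *)
Lemma norm_poincare_term (R : realType) (F : fieldExtType rat) (n : nat)
    (sigma : 'I_n -> {rmorphism F -> R}) (k : 'I_n -> nat) (nu : F) (t : R)
    (y : 'I_n -> R) (M : 'M[F]_2) :
  (forall j, sigma j nu * y j = t) -> \det M = 1 ->
  `|poincare_term sigma k nu (fun j => 0 +i* y j) M| =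
  (term_norm sigma k (2 * pi * t) y (M 1 0, M 1 1))%:C.
Proof.
move=> yt detM.
pose r j := Num.sqrt ((sigma j (M 1 0) * y j) ^+ 2 + sigma j (M 1 1) ^+ 2).
have normd j : `|denom sigma M (fun j => 0 +i* y j) j| = (r j)%:C.
  rewrite normc_def /denom /r; congr ((Num.sqrt _)%:C).
  by rewrite /=; ring.
rewrite /poincare_term normrM norm_cexp /term_norm /= big_split /= rmorphM.
congr (_ * _).
  rewrite /automorphy normr_prod rmorph_prod; apply: eq_bigr => j _.
  by rewrite -exprnN normfV normrX normd fmorphV rmorphXn.
rewrite -expR_sum; congr (expR _)%:C.
set Z := ztrace _ _ _.
have -> : complex.Re (2 * (pi : R)%:C * 'i%C * Z) = - (2 * pi * complex.Im Z).
  by case: Z => zr zi; rewrite /=; ring.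
rewrite /Z /ztrace Im_sum mulr_sumr -sumrN; apply: eq_bigr => j _.
congr (- _).
have -> : complex.Im ((sigma j nu)%:C * moebius sigma M (fun j => 0 +i* y j) j) =
    sigma j nu * complex.Im (moebius sigma M (fun j => 0 +i* y j) j).
  by case: (moebius _ _ _ _) => mr mi; rewrite /= mul0r addr0.
rewrite Im_moebius_imaginary -!rmorphM -rmorphB -det2 detM rmorph1 mul1r -/(r j).
rewrite sqr_sqrtr ?addr_ge0 ?sqr_ge0 // -(yt j) !mulrA.
by [].
Qed.

Definition pair_weight (R : realType) (F : fieldExtType rat) (n : nat)
    (sigma : 'I_n -> {rmorphism F -> R}) (p : F * F) : R :=
  (\prod_j weight (sigma j p.1)) * (\prod_j weight (sigma j p.2)).

Lemma prod_weight_ge0 (R : realType) (F : fieldExtType rat) (n : nat)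
    (sigma : 'I_n -> {rmorphism F -> R}) (x : F) :
  0 <= \prod_j weight (sigma j x).
Proof. by apply: prodr_ge0 => j _; rewrite ltW ?weight_gt0. Qed.

(** Enlarging the list to the product of its two projections makes the sum factor. *)
Lemma pair_sum_bound (R : realType) (F : fieldExtType rat) (n : nat)
    (sigma : 'I_n -> {rmorphism F -> R}) (nu : F) :
  \dim {:F} = n -> (forall i j, sigma i =1 sigma j -> i = j) ->
  dual_integers sigma nu -> totally_positive sigma nu ->
  exists K : R, forall s : seq (F * F), uniq s ->
    (forall p, p \in s -> integers p.1 /\ integers p.2) ->
    \sum_(p <- s) pair_weight sigma p <= K.
Proof.
move=> degF sigmaI nu_dual nu_pos.
have [K KP] := lattice_sum_bound degF sigmaI nu_dual nu_pos.
exists (K * K) => s us sP.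
pose s1 := undup (map fst s); pose s2 := undup (map snd s).
have s1P x : x \in s1 -> integers x.
  by rewrite mem_undup => /mapP[p /sP[pO _] ->].
have s2P x : x \in s2 -> integers x.
  by rewrite mem_undup => /mapP[p /sP[_ pO] ->].
apply: (@le_trans _ _ (\sum_(p <- [seq (x, y) | x <- s1, y <- s2]) pair_weight sigma p)).
  apply: ler_sum_subset => // [p|p ps]; first by rewrite mulr_ge0 ?prod_weight_ge0.
  apply/allpairsP; exists p; split; rewrite ?mem_undup ?map_f //.
  by case: p ps.
rewrite big_allpairs_dep /= /pair_weight /=.
under eq_bigr => x _ do rewrite -mulr_sumr.
rewrite -mulr_suml; apply: ler_pM; rewrite ?KP ?undup_uniq //.
  by apply: sumr_ge0 => x _; exact: prod_weight_ge0.
by apply: sumr_ge0 => x _; exact: prod_weight_ge0.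
Qed.

Lemma term_norm_ge0 (R : realType) (F : fieldExtType rat) (n : nat)
    (sigma : 'I_n -> {rmorphism F -> R}) (k : 'I_n -> nat) (c : R) (y : 'I_n -> R)
    (p : F * F) : 0 <= term_norm sigma k c y p.
Proof.
by apply: prodr_ge0 => j _; rewrite mulr_ge0 ?expR_ge0 // invr_ge0 exprn_ge0 ?sqrtr_ge0.
Qed.

(** A nonzero row makes every r_j positive, since embeddings are injective, so [term_bound] applies
    at each j. *)
Lemma term_norm_bound (R : realType) (F : fieldExtType rat) (n : nat)
    (sigma : 'I_n -> {rmorphism F -> R}) (k : 'I_n -> nat) (c : R) (y : 'I_n -> R) :
  0 < c -> (forall j, 0 < y j) -> (forall j, (2 < k j)%N) ->
  exists2 C : R, 0 < C & forall p : F * F, p != (0, 0) ->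
    term_norm sigma k c y p <= C * pair_weight sigma p.
Proof.
move=> c0 y0 k2.
have bnd j : exists C : R, 0 < C /\ forall g d r : R, 0 < r ->
    r ^+ 2 = (g * y j) ^+ 2 + d ^+ 2 ->
    r ^- k j * expR (- (c / r ^+ 2)) <= C * (weight g * weight d).
  by have [C C0 CP] := term_bound (y0 j) c0 (k2 j); exists C.
have [C CP] := choice bnd.
exists (\prod_j C j); first by apply: prodr_gt0 => j _; case: (CP j).
move=> p p0; rewrite /pair_weight -!big_split /=; apply: ler_prod => j _; apply/andP; split.
  by rewrite mulr_ge0 ?expR_ge0 // invr_ge0 exprn_ge0 ?sqrtr_ge0.
have sq_ge0 : 0 <= (sigma j p.1 * y j) ^+ 2 + sigma j p.2 ^+ 2 by rewrite addr_ge0 ?sqr_ge0.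
have [_ -> //] := CP j; last by rewrite sqr_sqrtr.
rewrite sqrtr_gt0 lt_neqAle sq_ge0 andbT eq_sym paddr_eq0 ?sqr_ge0 //.
apply: contra p0; rewrite !expf_eq0 /= mulf_eq0 (gt_eqF (y0 j)) orbF !fmorph_eq0.
by case: p sq_ge0 => a b _ /= /andP[/eqP -> /eqP ->].
Qed.

(** For gamma = 0 the point drops out, so [y] and [y'] are unrelated. The part [c] keeps summability
    while [c'] supplies decay. *)
Lemma term_norm_unit (R : realType) (F : fieldExtType rat) (n : nat)
    (sigma : 'I_n -> {rmorphism F -> R}) (k : 'I_n -> nat) (c c' : R)
    (y y' : 'I_n -> R) (d : F) :
  term_norm sigma k (c + c') y (0, d) =
  expR (- (c' * \sum_j sigma j d^-1 ^+ 2)) * term_norm sigma k c y' (0, d).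
Proof.
rewrite mulr_sumr -sumrN expR_sum /term_norm -big_split /=; apply: eq_bigr => j _.
rewrite !rmorph0 !mul0r expr0n add0r sqr_sqrtr ?sqr_ge0 // mulrCA; congr (_ * _).
by rewrite -expRD fmorphV exprVn mulrDl opprD addrC.
Qed.

(** The exact value is required, not only its modulus, to see that the terms of 1 and -1 add up. *)
Lemma poincare_term1 (R : realType) (F : fieldExtType rat) (n : nat)
    (sigma : 'I_n -> {rmorphism F -> R}) (k : 'I_n -> nat) (nu : F) (t : R)
    (y : 'I_n -> R) :
  (forall j, sigma j nu * y j = t) ->
  poincare_term sigma k nu (fun j => 0 +i* y j) 1%:M = (expR (- (2 * pi * t * n%:R)))%:C.
Proof.
move=> yt; rewrite /poincare_term.
have dE j : denom sigma 1%:M (fun j => 0 +i* y j) j = 1.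
  by rewrite /denom !mxE /= rmorph0 rmorph1 mul0r add0r.
rewrite /automorphy big1 ?mul1r; last by move=> j _; rewrite dE exp1rz.
have -> : ztrace sigma nu (moebius sigma 1%:M (fun j => 0 +i* y j)) = 0 +i* (t * n%:R).
  rewrite /ztrace (eq_bigr (fun _ => 0 +i* t)).
    rewrite sumr_const card_ord -[LHS]mulr_natr.
    have -> : (n%:R : R[i]) = (n%:R : R)%:C by rewrite rmorph_nat.
    by apply/eqP; rewrite eq_complex /= !mulr0 !mul0r subr0 add0r !eqxx.
  move=> j _; rewrite /moebius dE divr1 !mxE /= rmorph0 rmorph1 mul1r addr0 -(yt j).
  by apply/eqP; rewrite eq_complex /= !mulr0 !mul0r subr0 addr0 !eqxx.
have -> : 2 * (pi : R)%:C * 'i%C * (0 +i* (t * n%:R)) = (- (2 * pi * t * n%:R))%:C.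
  by apply/eqP; rewrite eq_complex; apply/andP; split; apply/eqP => /=; ring.
rewrite /cexp /= cos0 sin0.
by apply/eqP; rewrite eq_complex; apply/andP; split; apply/eqP => /=; ring.
Qed.

(** * Rows other than (0, 1) and (0, -1) *)

(** Used in contrapositive form: an ideal of norm above [b] contains no nonzero gamma occurring in
    [s]. *)
Lemma ideal_norm_bound_seq (R : realType) (F : fieldExtType rat) (n : nat)
    (sigma : 'I_n -> {rmorphism F -> R}) (nu : F) (s : seq (F * F)) :
  \dim {:F} = n -> (forall i j, sigma i =1 sigma j -> i = j) ->
  dual_integers sigma nu -> totally_positive sigma nu ->
  exists b : nat, forall I p, integral_ideal I -> p \in s -> p.1 != 0 -> I p.1 ->
    (ideal_norm I <= b)%N.
Proof.
move=> degF sigmaI nu_dual nu_pos; elim: s => [|p s [b bP]]; first by exists 0%N.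
have [p0|p0] := eqVneq p.1 0.
  exists b => I q IP; rewrite in_cons => /predU1P[->|]; first by rewrite p0 eqxx.
  exact: bP.
have [b' b'P] := ideal_norm_bound degF sigmaI nu_dual nu_pos p0.
exists (maxn b b') => I q IP; rewrite in_cons => /predU1P[-> _ Ip|qs q0 Iq].
  by rewrite leq_max b'P ?orbT.
by rewrite leq_max (bP I q).
Qed.

(** Left multiplication by [Gamma_inf] fixes the bottom row, so the member of the coset picked by
    [xget] is immaterial. *)
Definition bottom_row (F : fieldExtType rat) (C : set 'M[F]_2) : F * F :=
  ((xget 0 C) 1 0, (xget 0 C) 1 1).

Lemma bottom_row_inj (F : fieldExtType rat) (I : set F) (C D : set 'M[F]_2) :
  quotient_inf I C -> quotient_inf I D -> bottom_row C = bottom_row D -> C = D.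
Proof.
move=> /coset_inf_rep[[CP _] CE] /coset_inf_rep[[DP _] DE] [e0 e1].
by rewrite -CE -DE; exact: coset_inf_bottom_row.
Qed.

Lemma SL2_integers1 (F : fieldExtType rat) : @SL2_integers F 1%:M.
Proof.
split=> [i j|]; rewrite ?det1 // mxE.
by case: (i == j); [exact: (@integers_int F 1)|exact: (@integers_int F 0)].
Qed.

Lemma SL2_integersN1 (F : fieldExtType rat) : @SL2_integers F (- 1%:M).
Proof.
split=> [i j|]; first by rewrite mxE; apply: integersN; case: (SL2_integers1 F).
by rewrite det2 !mxE /= !oppr0 mulrNN mulr1 mulr0 subr0.
Qed.

(** The determinant makes the inverse of delta equal to alpha, an integer. The conclusion concerns
    this inverse because [unit_gap] is applied to it. *)
Lemma bottom_row_unit (F : fieldExtType rat) (I : set F) (D : set 'M[F]_2) :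
  quotient_inf I D -> (bottom_row D).1 = 0 ->
  D <> coset_inf 1%:M -> D <> coset_inf (- 1%:M) ->
  let d := (bottom_row D).2 in
  [/\ d != 0, integers d^-1, d^-1 != 1 & d^-1 != -1].
Proof.
move=> /coset_inf_rep[[[DO dD] _] DE] /= D10 D1 DN1.
move: (dD); rewrite det2 D10 mulr0 subr0 => dD'.
have D11 : (xget 0 D) 1 1 != 0.
  by apply/eqP => D11; move/eqP: dD'; rewrite D11 mulr0 eq_sym oner_eq0.
have iE : ((xget 0 D) 1 1)^-1 = (xget 0 D) 0 0.
  by rewrite -[RHS](mulfK D11) dD' mul1r.
split; [exact: D11|rewrite iE; exact: DO| |];
  rewrite iE; apply/eqP => D00; move: dD'; rewrite D00.
  rewrite mul1r => D11'; apply: D1; rewrite -DE.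
  by apply: coset_inf_bottom_row; rewrite ?D10 ?D11' ?mxE //; exact: SL2_integers1.
rewrite mulN1r => /eqP; rewrite eqr_oppLR => /eqP D11'; apply: DN1; rewrite -DE.
apply: coset_inf_bottom_row; rewrite ?D10 ?D11' ?mxE //= ?oppr0 //.
exact: SL2_integersN1.
Qed.

(* By the gap of [unit_gap], the terms of the other units decay strictly faster
   in [t] than those of the units 1 and -1. *)
Lemma unit_terms_small (R : realType) (F : fieldExtType rat) (n : nat)
    (sigma : 'I_n -> {rmorphism F -> R}) (k : 'I_n -> nat) (nu : F) :
  \dim {:F} = n -> (forall i j, sigma i =1 sigma j -> i = j) ->
  dual_integers sigma nu -> totally_positive sigma nu -> (forall j, (2 < k j)%N) ->
  exists2 t : R, 0 < t & forall (y : 'I_n -> R) (l : seq (F * F)), uniq l ->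
    (forall p, p \in l -> p.1 = 0 /\ integers p.2) ->
    (forall p, p \in l ->
      [/\ p.2 != 0, integers p.2^-1, p.2^-1 != 1 & p.2^-1 != -1]) ->
    \sum_(p <- l) term_norm sigma k (2 * pi * t) y p <=
    expR (- (2 * pi * t * n%:R)) / 2.
Proof.
move=> degF sigmaI nu_dual nu_pos k_gt2.
have pi2 : 0 < 2 * pi :> R by rewrite mulr_gt0 ?pi_gt0.
have [K KP] := pair_sum_bound degF sigmaI nu_dual nu_pos.
have K0 : 0 <= K by have := KP [::] isT; rewrite big_nil; apply.
have [gap gap0 gapP] := unit_gap degF sigmaI nu_dual nu_pos.
(* [C1] belongs to this reference point and to [c] = 2 pi, so it is fixed before [t] is chosen. *)
pose y1 (j : 'I_n) : R := 1.
have y1_gt0 j : 0 < y1 j by exact: ltr01.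
have [C1 C1_gt0 C1P] := term_norm_bound sigma pi2 y1_gt0 k_gt2.
(* With 2 pi t = 2 pi + A and A * gap = X, the claim reduces to X <= exp X. *)
pose X := 2 * (C1 * K * expR (2 * pi * n%:R)).
have X0 : 0 <= X by rewrite !mulr_ge0 ?expR_ge0 // ltW.
pose A := X / gap.
have A0 : 0 <= A by rewrite divr_ge0 // ltW.
exists (1 + A / (2 * pi)); first by rewrite ltr_pwDl // divr_ge0 // ltW.
move=> y l ul lO lU.
have -> : 2 * pi * (1 + A / (2 * pi)) = 2 * pi + A.
  by rewrite mulrDr mulr1 [_ * (A / _)]mulrC divfK ?gt_eqF.
apply: (@le_trans _ _ (\sum_(p <- l)
    expR (- (A * (n%:R + gap))) * (C1 * pair_weight sigma p))).
  rewrite big_seq [leRHS]big_seq; apply: ler_sum => p pl.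
  have [p2 p2i p21 p2N1] := lU p pl; have [p10 _] := lO p pl.
  have pE : p = (0, p.2) by rewrite -p10; case: (p).
  rewrite [in leLHS]pE (term_norm_unit _ _ _ _ _ y1) -pE.
  apply: ler_pM; rewrite ?expR_ge0 ?term_norm_ge0 //; last first.
    by apply: C1P; apply: contra p2 => /eqP ->.
  by rewrite ler_expR lerN2 ler_wpM2l // gapP // invr_eq0.
rewrite -!mulr_sumr.
apply: (@le_trans _ _ (expR (- (A * (n%:R + gap))) * (C1 * K))).
  rewrite !ler_wpM2l ?expR_ge0 ?(ltW C1_gt0) // KP //.
  by move=> p /lO[-> ?]; split=> //; exact: (@integers_int F 0).
have -> : expR (- (A * (n%:R + gap))) =
    expR (- ((2 * pi + A) * n%:R)) * (expR (2 * pi * n%:R) * expR (- X)).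
  rewrite -!expRD; congr expR.
  have -> : X = A * gap by rewrite divfK ?gt_eqF.
  by ring.
rewrite -mulrA ler_wpM2l ?expR_ge0 // mulrAC expRN ler_pdivrMr ?expR_gt0 //.
have := expR_ge1Dx X; rewrite {1}/X; lra.
Qed.

(** * Nonvanishing at one point for all ideals of large norm *)

Theorem theorem4p4 (R : realType) (F : fieldExtType rat) (n : nat)
    (sigma : 'I_n -> {rmorphism F -> R})
    (degF : \dim {:F} = n)
    (realF : totally_real R F)
    (sigmaP : enumerates_real_embeddings sigma)
    (k : 'I_n -> nat)
    (k_gt2 : forall j, (2 < k j)%N)
    (k_even : ~~ odd (\sum_j k j)%N)
    (nu : F)
    (nu_dual : dual_integers sigma nu)
    (nu_pos : totally_positive sigma nu) :
  exists n0 : R, 0 < n0 /\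
    forall I : set F, integral_ideal I -> I <> [set 0] ->
      n0 <= (ideal_norm I)%:R ->
      exists z : 'I_n -> R[i],
        upper_half z /\ poincare sigma k nu I z <> 0.
Proof.
have [sigmaI _] := sigmaP.
have pi2 : 0 < 2 * pi :> R by rewrite mulr_gt0 ?pi_gt0.
have [K KP] := pair_sum_bound degF sigmaI nu_dual nu_pos.
have [t t0 unit_small] := unit_terms_small degF sigmaI nu_dual nu_pos k_gt2.
pose y j := t / sigma j nu.
have y_gt0 j : 0 < y j by rewrite divr_gt0 ?nu_pos.
have yt j : sigma j nu * y j = t by rewrite mulrC divfK // gt_eqF ?nu_pos.
have [C C_gt0 CP] := term_norm_bound sigma (mulr_gt0 pi2 t0) y_gt0 k_gt2.
pose E := expR (- (2 * pi * t * n%:R)).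
have E0 : 0 < E by exact: expR_gt0.
(* The terms of 1 and -1 give 2 E; the other units and the rows with gamma nonzero are each allowed
   E / 2. *)
have tail0 : 0 < E / 2 / C by rewrite !divr_gt0.
have [s0 s0P] := sum_tail KP tail0.
have [b bP] := ideal_norm_bound_seq s0 degF sigmaI nu_dual nu_pos.
(* The successor gives norm strictly above [b], so that [bP] excludes the nonzero gammas of [s0]. *)
exists b.+1%:R; split=> [|I IP _]; first by rewrite ltr0n.
rewrite ler_nat => bI; have [_ I0 _ _] := IP.
pose z : 'I_n -> R[i] := fun j => 0 +i* y j.
have zP : upper_half z by move=> j; exact: y_gt0.
exists z; split=> //.
pose g (D : set 'M[F]_2) : R :=
  if D \in quotient_inf I then term_norm sigma k (2 * pi * t) y (bottom_row D) else 0.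
have G1 : Gamma0 I 1%:M by split; [exact: SL2_integers1|rewrite mxE].
have GN1 : Gamma0 I (- 1%:M) by split; [exact: SL2_integersN1|rewrite !mxE oppr0].
have rep M : Gamma0 I M ->
    poincare_term sigma k nu z (xget 0 (coset_inf M)) = poincare_term sigma k nu z M.
  move=> MP; have [U UP <-] : coset_inf M (xget 0 (coset_inf M)).
    by apply: xgetPex; exists M; exact: coset_inf_refl.
  by rewrite poincare_term_coset //; case: MP => -[].
have Q1 : coset_inf 1%:M \in quotient_inf I by rewrite inE; exists 1%:M.
have QN1 : coset_inf (- 1%:M) \in quotient_inf I by rewrite inE; exists (- 1%:M).
apply: (@sum_neq0 _ _ _ g (coset_inf 1%:M) (coset_inf (- 1%:M)) (E + E) E).
(* Were the cosets equal, the lower right entries would give 1 = -1 in [F]. *)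
- apply/eqP => e.
  have [U [_ _ U11 _] /matrixP/(_ 1 1)] : coset_inf (- 1%:M) (1%:M : 'M[F]_2).
    by rewrite -e; exact: coset_inf_refl.
  rewrite mulmx2E !mxE /= oppr0 mulr0 add0r U11 mul1r => /eqP.
  by rewrite -subr_eq0 -opprD oppr_eq0 -(intrD F 1 1) intr_fieldExt_eq0.
(* The even sum of weights gives -1 the same term as 1, instead of its opposite. *)
- rewrite Q1 QN1 !rep // poincare_termN -signr_odd (negPf k_even) expr0 mul1r.
  by rewrite (poincare_term1 _ yt) -rmorphD.
- move=> D; rewrite /g; case: ifPn => [|_]; last by rewrite normr0.
  rewrite inE => /coset_inf_rep[[[_ dD] _] _].
  by rewrite (norm_poincare_term _ yt dD).
- move=> s us s1 sN1.
  pose q := [seq D <- s | D \in quotient_inf I]; pose l := map (@bottom_row F) q.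
  have qP D : D \in q -> quotient_inf I D /\ D \in s.
    by rewrite mem_filter => /andP[/set_mem].
  have ul : uniq l.
    rewrite map_inj_in_uniq ?filter_uniq // => D D' /qP[DQ _] /qP[D'Q _].
    exact: (bottom_row_inj DQ D'Q).
  have lO p : p \in l -> integers p.1 /\ integers p.2.
    by move=> /mapP[D /qP[/coset_inf_rep[[[DO _] _] _] _] ->]; split; exact: DO.
  have lI p : p \in l -> I p.1.
    by move=> /mapP[D /qP[/coset_inf_rep[[_ DI] _] _] ->].
  have -> : \sum_(D <- s) g D = \sum_(p <- l) term_norm sigma k (2 * pi * t) y p.
    by rewrite big_map big_filter [RHS]big_mkcond.
  rewrite (bigID (fun p => p.1 == 0)) /= [leRHS](splitr E).
  apply: lerD; rewrite -big_filter; set l' := seq.filter _ _.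
    have l'P p : p \in l' -> p.1 = 0 /\ p \in l by rewrite mem_filter => /andP[/eqP].
    apply: unit_small => [|p /l'P[p1 /lO[]]|p /l'P[+ /mapP[D /qP[DQ Ds] pE]]] //.
      by rewrite filter_uniq.
    rewrite pE => D1; apply: (bottom_row_unit DQ D1) => DE.
      by move: s1; rewrite -DE Ds.
    by move: sN1; rewrite -DE Ds.
  have l'P p : p \in l' -> p.1 != 0 /\ p \in l by rewrite mem_filter => /andP[].
  apply: (@le_trans _ _ (\sum_(p <- l') C * pair_weight sigma p)).
    rewrite big_seq [leRHS]big_seq; apply: ler_sum => p /l'P[p10 pl].
    by apply: CP; apply: contra p10 => /eqP ->.
  rewrite -mulr_sumr mulrC -ler_pdivlMr //; apply: s0P; first by rewrite filter_uniq.
    by move=> p /l'P[_]; exact: lO.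
  (* A row shared with [s0] would put one of its nonzero gammas in [I] and bound the norm by [b]. *)
  move=> p /l'P[p10 pl]; apply/negP => ps0.
  by move: bI; rewrite ltnNge (bP I p) //; exact: lI.
- by rewrite ltrDl.
Qed.
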